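(* Let $\Gamma$ be a compact metric graph with vertices $v_1,\dots,v_{|\mathcal V|}$, let $\kappa,\tau>0$, let $\alpha=1$, and let $u$ be the Whittle--Matérn field solving $(\kappa^2-\Delta_\Gamma)^{1/2}(\tau u)=\mathcal W$ on $\Gamma$. Then $\mathbf U_v=(u(v_1),\dots,u(v_{|\mathcal V|}))^\top$ satisfies $\mathbf U_v\sim\mathsf N(\mathbf 0,\mathbf Q^{-1})$, where $$Q_{ij}=2\kappa\tau^2\cdot\begin{cases}\displaystyle\sum_{e\in\mathcal E_{v_i}}\left[\left(\frac12+\frac{e^{-2\kappa\ell_e}}{1-e^{-2\kappa\ell_e}}\right)\mathbb I(\bar e\neq\underline e)+\tanh\!\left(\kappa\frac{\ell_e}{2}\right)\mathbb I(\bar e=\underline e)\right]&\text{if }i=j,\\[2ex]\displaystyle\sum_{e\in\mathcal E_{v_i}\cap\mathcal E_{v_j}}-\frac{e^{-\kappa\ell_e}}{1-e^{-2\kappa\ell_e}}&\text{if }i\neq j.\end{cases}$$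
   Context: Compact metric graph: $\Gamma$ consists of a finite set $\mathcal V$ of vertices and a finite set $\mathcal E$ of edges; each edge $e$ is identified by arc length with $[0,\ell_e]$, $0<\ell_e<\infty$, whose endpoints $t=0$, $t=\ell_e$ are vertices $\underline e,\bar e$ (loops, i.e. $\underline e=\bar e$, and multiple edges are allowed). $\Gamma$ is connected. $f_e$ is the restriction of $f$ to $e$; $\mathcal E_v$ is the set of edges incident to $v$ (in the formula for $Q_{ii}$ each loop at $v_i$ appears once). $L_2(\Gamma)=\bigoplus_{e}L_2(e)$; $C(\Gamma)$ is the space of continuous functions. $\mathbb I$ is the indicator. Kirchhoff--Laplacian: for an edge $e$ incident to $v$, $\partial_e f(v)$ is the derivative of $f_e$ at $v$ directed away from $v$ ($f_e'(0)$ at $\underline e$, $-f_e'(\ell_e)$ at $\bar e$; a loop contributes both ends to vertex sums). $\Delta_\Gamma$ has domain $\{f\in C(\Gamma): f_e\in H^2(e)\ \forall e,\ \sum_{e\in\mathcal E_v}\partial_e f(v)=0\ \forall v\in\mathcal V\}$ and acts as $(\Delta_\Gamma f)_e=f_e''$. $L=\kappa^2-\Delta_\Gamma$ is self-adjoint, strictly positive, with discrete spectrum; powers are defined spectrally. Whittle--Matérn field ($\alpha=1$): $\mathcal W$ is Gaussian white noise on $L_2(\Gamma)$ (centered Gaussian family with $\mathbb E[\mathcal W(h)\mathcal W(g)]=(h,g)_{L_2(\Gamma)}$), and $u$ is the centered Gaussian field with $(u,\psi)_{L_2(\Gamma)}=\mathcal W(\tau^{-1}L^{-1/2}\psi)$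 a.s. for all $\psi\in L_2(\Gamma)$, in its continuous modification. *)

(* Defs.v *)
From HB Require Import structures.
From mathcomp Require Import all_boot all_order all_algebra.
From mathcomp Require Import all_classical all_reals all_analysis.
Set Implicit Arguments.
Unset Strict Implicit.
Unset Printing Implicit Defensive.
Import Order.TTheory GRing.Theory Num.Theory.
Import numFieldNormedType.Exports.
Local Open Scope classical_set_scope.
Local Open Scope ring_scope.

(* The edge e is the interval [0, len e], with 0 at [edge_tail e] and len e at
   [edge_head e].  Having an edge is part of being a metric graph (a union of
   intervals): it only rules out a single isolated vertex. *)
Record metric_graph (R : realType) := MetricGraph {
  vertex : finType;
  edge : finType;
  edge_tail : edge -> vertex;
  edge_head : edge -> vertex;
  len : edge -> R;
  len_gt0 : forall e, 0 < len e;
  edge_nonempty : (0 < #|edge|)%N;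
  graph_connected : forall x y : vertex,
    connect (fun a b => [exists e,
      ((edge_tail e == a) && (edge_head e == b)) ||
      ((edge_tail e == b) && (edge_head e == a))]) x y
}.

Section MetricGraph.
Context {R : realType} {G : metric_graph R}.
Implicit Types (e : edge G) (psi : edge G -> R -> R).

(* The points of the graph: edges glued along their endpoints. *)
Inductive graph_point : Type :=
  | Vertex of vertex G
  | Interior (e : edge G) of {t : R | 0 < t < len e}.

(* The point at arc length t on e; only t in [0, len e] is meaningful. *)
Definition edge_point e (t : R) : graph_point :=
  if (insub t : option {t : R | 0 < t < len e}) is Some s then Interior s
  else Vertex (if t <= 0 then edge_tail e else edge_head e).

Definition restr (f : graph_point -> R) (e : edge G) (t : R) : R :=
  f (edge_point e t).

Definition incident e (x : vertex G) : bool :=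
  (edge_tail e == x) || (edge_head e == x).

(* C(Gamma), for the quotient topology on the glued edges. *)
Definition continuous_graph (f : graph_point -> R) : Prop :=
  forall e, {within `[0, len e], continuous (restr f e)}.

Definition L2_itv (l : R) (f : R -> R) : Prop :=
  measurable_fun `[0, l] f /\
  (@lebesgue_measure R).-integrable `[0, l] (EFin \o (fun t => f t ^+ 2)).

(* Elements of L2(Gamma) are represented by functions on the edges, not by
   classes modulo equality almost everywhere. *)
Definition L2_graph psi : Prop := forall e, L2_itv (len e) (psi e).

Definition L2_inner psi1 psi2 : R :=
  \sum_e \int[lebesgue_measure]_(t in `[0, len e]) (psi1 e t * psi2 e t).

Definition L2_cvg (psis : nat -> edge G -> R -> R) psi : Prop :=
  (fun n => L2_inner (fun e t => psis n e t - psi e t)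
                     (fun e t => psis n e t - psi e t)) @ \oo --> (0 : R).

(* C^1 functions with compact support in the open interval ]0, l[. *)
Definition test_function (l : R) (phi : R -> R) : Prop :=
  [/\ forall t, derivable phi t 1, continuous (derive1 phi) &
      exists a b, [/\ 0 < a, b < l & forall t, t \notin `[a, b] -> phi t = 0]].

Definition weak_derivative (l : R) (f g : R -> R) : Prop :=
  forall phi, test_function l phi ->
    \int[lebesgue_measure]_(t in `[0, l]) (f t * derive1 phi t) =
    - \int[lebesgue_measure]_(t in `[0, l]) (g t * phi t).

(* f belongs to H^2(0, l) and g represents its second weak derivative. *)
Definition H2_with_second_derivative (l : R) (f g : R -> R) : Prop :=
  exists f1, [/\ L2_itv l f, L2_itv l f1, L2_itv l g,
                 weak_derivative l f f1 & weak_derivative l f1 g].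

(* Derivatives at the two ends of e, in the direction pointing into e:
   f_e'(0) and - f_e'(len e). *)
Definition deriv_tail (f : graph_point -> R) e : R :=
  lim ((restr f e h - restr f e 0) / h @[h --> 0^'+]).

Definition deriv_head (f : graph_point -> R) e : R :=
  lim ((restr f e (len e - h) - restr f e (len e)) / h @[h --> 0^'+]).

(* A loop at x occurs in both sums. *)
Definition kirchhoff (f : graph_point -> R) : Prop :=
  forall x : vertex G,
    \sum_(e | edge_tail e == x) deriv_tail f e +
    \sum_(e | edge_head e == x) deriv_head f e = 0.

(* The graph of the operator: f is in the domain of the Kirchhoff Laplacian and
   g represents its image. *)
Definition kirchhoff_laplacian (f : graph_point -> R)
    (g : edge G -> R -> R) : Prop :=
  [/\ continuous_graph f,
      forall e, H2_with_second_derivative (len e) (restr f e) (g e) &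
      kirchhoff f].

(* (kappa^2 - Delta) f = g *)
Definition whittle_operator (kappa : R) (f : graph_point -> R)
    (g : edge G -> R -> R) : Prop :=
  kirchhoff_laplacian f (fun e t => kappa ^+ 2 * restr f e t - g e t).

Definition eigenbasis (kappa : R) (lambda : nat -> R)
    (phi : nat -> graph_point -> R) : Prop :=
  [/\ forall k, whittle_operator kappa (phi k)
        (fun e t => lambda k * restr (phi k) e t),
      forall j k, L2_inner (restr (phi j)) (restr (phi k)) = (j == k)%:R &
      forall psi, L2_graph psi ->
        L2_cvg (fun n e t => \sum_(k < n)
          L2_inner psi (restr (phi k)) * restr (phi k) e t) psi].

(* T = (kappa^2 - Delta)^s for s <= 0 (bounded, defined on all of L2(Gamma)):
   T psi is the sum of the lambda_k^s (psi, phi_k) phi_k. *)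
Definition whittle_power (kappa s : R)
    (T : (edge G -> R -> R) -> edge G -> R -> R) : Prop :=
  exists lambda phi, eigenbasis kappa lambda phi /\
    forall psi, L2_graph psi -> L2_graph (T psi) /\
      L2_cvg (fun n e t => \sum_(k < n) (lambda k `^ s) *
        L2_inner psi (restr (phi k)) * restr (phi k) e t) (T psi).

End MetricGraph.
Arguments graph_point {R} G.

Section Gaussian.
Context {R : realType} {d : measure_display} {Omega : measurableType d}.
Variable P : probability Omega R.

(* X ~ N(m, v), v being the variance; [normal_prob] takes the standard
   deviation and is a uniform law when it is 0. *)
Definition normal_law (X : Omega -> R) (m v : R) : Prop :=
  0 <= v /\ forall A : set R, measurable A ->
    P (X @^-1` A) = if v == 0 then \d_m A else normal_prob m (Num.sqrt v) A.

(* X ~ N(mu, Sigma), through one-dimensional projections; Sigma is allowed to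
   be singular. *)
Definition multivariate_normal (n : nat) (X : 'I_n -> {RV P >-> R})
    (mu : 'cV[R]_n) (Sigma : 'M[R]_n) : Prop :=
  Sigma^T = Sigma /\
  forall a : 'cV[R]_n,
    normal_law (fun w => \sum_i a i 0 * X i w)
      ((a^T *m mu) 0 0) ((a^T *m Sigma *m a) 0 0).

Definition centered_gaussian_family (I : Type) (D : set I)
    (X : I -> {RV P >-> R}) : Prop :=
  forall (n : nat) (t : 'I_n -> I), (forall i, D (t i)) ->
    exists Sigma, multivariate_normal (fun i => X (t i)) 0 Sigma.

(* Only the values of W on L2(Gamma) matter. *)
Definition white_noise (G : metric_graph R)
    (W : (edge G -> R -> R) -> {RV P >-> R}) : Prop :=
  centered_gaussian_family L2_graph W /\
  forall h g, L2_graph h -> L2_graph g ->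
    ('E_P[(fun w => W h w * W g w)%R] = (L2_inner h g)%:E)%E.

(* u solves (kappa^2 - Delta)^(alpha/2) (tau u) = W and has almost surely
   continuous sample paths. *)
Definition whittle_matern (G : metric_graph R) (kappa tau alpha : R)
    (W : (edge G -> R -> R) -> {RV P >-> R})
    (u : graph_point G -> {RV P >-> R}) : Prop :=
  [/\ centered_gaussian_family setT u,
      {ae P, forall w, continuous_graph (fun x => u x w)} &
      exists2 T, whittle_power kappa (- (alpha / 2)) T &
        forall psi, L2_graph psi ->
          {ae P, forall w, L2_inner (restr (fun x => u x w)) psi =
                           W (fun e t => tau^-1 * T psi e t) w}].

End Gaussian.

Definition tanh {R : realType} (x : R) : R :=
  (expR x - expR (- x)) / (expR x + expR (- x)).

Definition precision (R : realType) (G : metric_graph R) (kappa tau : R)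
    (n : nat) (v : 'I_n -> vertex G) : 'M[R]_n :=
  \matrix_(i, j) (2 * kappa * tau ^+ 2 *
    if i == j then
      \sum_(e | incident e (v i))
        ((1 / 2 + expR (- 2 * kappa * len e) / (1 - expR (- 2 * kappa * len e)))
           * (edge_head e != edge_tail e)%:R
         + tanh (kappa * (len e / 2)) * (edge_head e == edge_tail e)%:R)
    else
      \sum_(e | incident e (v i) && incident e (v j))
        - (expR (- kappa * len e) / (1 - expR (- 2 * kappa * len e)))).

(* Main.v *)
(* On each edge let f be the solution of f'' = kappa^2 f with prescribed values
   at the two ends.  For vertex values b, the vector tau^-2 Q b consists of
   minus the vertex sums of the derivatives of f directed into the edges, and the
   energy of f is tau^-2 b^T Q b; in particular Q is symmetric and positive
   definite.

   Correcting f near the ends of each edge gives functions g_n with vanishing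
   derivatives at the vertices, so that g_n is in the domain of the operator L,
   while L g_n is a combination of approximate identities at the vertices and
   tends to the measure with weights tau^-2 Q b.  Hence
   (u, L g_n) = W(tau^-1 L^(-1/2) L g_n) tends almost surely to
   tau^-2 (Q b) . U_v, whereas its variance is tau^-2 (g_n, L g_n), which tends
   to tau^-4 b^T Q b.  Take b = tau^2 Q^-1 a.  The variance of the Gaussian limit
   a . U_v is identified by dominated convergence for exp(-x^2), whose mean under
   N(0, v) is (1 + 2 v)^(-1/2).

   The identity |L^(-1/2) L g|^2 = (g, L g) follows from the spectral definition
   of the powers once (L g, phi) = lambda (g, phi) for every eigenfunction phi,
   i.e. from Green's formula, which needs phi to be C^2 up to the ends of the
   edges: this is a du Bois-Reymond lemma for second weak derivatives. *)

Require Import Defs.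
From HB Require Import structures.
From mathcomp Require Import all_boot all_order all_algebra.
From mathcomp Require Import all_classical all_reals all_analysis.
From mathcomp Require Import measurable_realfun ring lra.
Set Implicit Arguments.
Unset Strict Implicit.
Unset Printing Implicit Defensive.
Import Order.TTheory GRing.Theory Num.Theory.
Import numFieldNormedType.Exports.
Local Open Scope classical_set_scope.
Local Open Scope ring_scope.

(** * Calculus on the real line *)

Section Calculus.
Context {R : realType}.
Implicit Types (f g h F G : R -> R) (a b l x t : R).
Local Notation mu := (@lebesgue_measure R).

(** Precomposing with this projection onto [[0, l]] turns a function continuous on the segment only
    into one continuous on the whole line, to which the calculus below applies. *)
Definition clamp l t : R := Num.max 0 (Num.min t l).

Lemma clamp_itv l t : 0 <= l -> clamp l t \in `[0, l].
Proof.
move=> l0; rewrite in_itv/= /clamp le_max lexx/= ge_max l0/=.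
by rewrite ge_min lexx orbT.
Qed.

Lemma clamp_id l t : t \in `[0, l] -> clamp l t = t.
Proof.
by rewrite in_itv/= => /andP[t0 tl]; rewrite /clamp (min_l tl) (max_r t0).
Qed.

Lemma continuous_clamp l f : 0 <= l -> {within `[0, l], continuous f} ->
  continuous (f \o clamp l).
Proof.
move=> l0 /subspace_continuousP cf x.
have cx := clamp_itv x l0.
apply: cvg_comp; last by apply: cf.
have cl : {for x, continuous (clamp l)}.
  apply: (@continuous_max _ _ (cst 0) (fun t => Num.min t l)).
    exact: cst_continuous.
  by apply: (@continuous_min _ _ id (cst l)) => //; exact: cst_continuous.
move=> A /=; rewrite /within /= => wA.
have : nbhs x (fun z => clamp l z \in `[0, l] -> A (clamp l z)).
  exact: (cl _ wA).
by apply: filterS => y; apply; exact: clamp_itv.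
Qed.

Lemma continuous_integrable f a b : continuous f ->
  mu.-integrable `[a, b] (EFin \o f).
Proof.
move=> cf; apply: continuous_compact_integrable; first exact: segment_compact.
exact: continuous_subspaceT.
Qed.

Lemma is_derive_continuous f g : (forall t, is_derive t 1 f (g t)) ->
  continuous f.
Proof.
by move=> fg t; apply: differentiable_continuous; apply/derivable1_diffP.
Qed.

Lemma is_derive_derive1 f g : (forall t, is_derive t 1 f (g t)) ->
  derive1 f = g.
Proof. by move=> fg; apply/funext => t; rewrite derive1E derive_val. Qed.


Lemma derivable_oo_of_is_derive f g a b : (forall t, is_derive t 1 f (g t)) ->
  derivable_oo_LRcontinuous f a b.
Proof.
move=> fg; have cf := is_derive_continuous fg; split=> //.
- by apply: cvg_at_right_filter; exact: cf.
- by apply: cvg_at_left_filter; exact: cf.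
Qed.

Lemma Rintegral_is_derive F f a b : a < b -> continuous f ->
  (forall t, is_derive t 1 F (f t)) ->
  \int[mu]_(t in `[a, b]) f t = F b - F a.
Proof.
move=> ab cf dF; rewrite /Rintegral (@continuous_FTC2 _ f F)//.
- exact: continuous_subspaceT.
- exact: derivable_oo_of_is_derive dF.
- by move=> t _; rewrite (is_derive_derive1 dF).
Qed.

Lemma Rintegral_by_parts F G f g a b : a < b -> continuous f -> continuous g ->
  (forall t, is_derive t 1 F (f t)) -> (forall t, is_derive t 1 G (g t)) ->
  \int[mu]_(t in `[a, b]) (F t * g t) =
  F b * G b - F a * G a - \int[mu]_(t in `[a, b]) (f t * G t).
Proof.
move=> ab cf cg dF dG.
rewrite (@Rintegration_by_parts _ F G f g)//; try exact: continuous_subspaceT.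
- exact: derivable_oo_of_is_derive dF.
- by move=> t _; rewrite (is_derive_derive1 dF).
- exact: derivable_oo_of_is_derive dG.
- by move=> t _; rewrite (is_derive_derive1 dG).
Qed.

(* The integral from 0 to x is taken as a difference of integrals from a base
   point lying to the left of both 0 and x. *)
Lemma continuous_primitive f : continuous f ->
  exists F, F 0 = 0 /\ forall t, is_derive t 1 F (f t).
Proof.
move=> cf.
pose I a x := \int[mu]_(t in `[a, x]) f t.
have IB a b x : a <= b -> b <= x ->
    I a x - I a b = \int[mu]_(t in `]b, x]) f t.
  by move=> ab bx; rewrite /I Rintegral_itvB//; exact: continuous_integrable.
pose F x := I (- (`|x| + 1)) x - I (- (`|x| + 1)) 0.
(* The increment is independent of the base point, so near a given x the moving base point of [F]
   can be replaced by a fixed one. *)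
have FE c x : c <= 0 -> c <= x -> F x = I c x - I c 0.
  move=> c0 cx; rewrite /F; set d := - _.
  have d0 : d <= 0 by rewrite /d oppr_le0 addr_ge0.
  have dx : d <= x by rewrite /d lerNl; have := ler_norm (- x); rewrite normrN; lra.
  wlog [m [mc md]] : / exists m, m <= c /\ m <= d.
    by apply; exists (Num.min c d); rewrite !ge_min !lexx orbT.
  have [x0|x0] := leP x 0.
    by rewrite -(opprB (I d 0)) -(opprB (I c 0)) !IB.
  by rewrite !IB// ltW.
exists F; split; first by rewrite /F subrr.
move=> x; pose c := - (`|x| + 1).
have cx : c < x.
  by rewrite /c ltrNl; have := ler_norm (- x); rewrite normrN; lra.
have c0 : c <= 0 by rewrite /c oppr_le0 addr_ge0.
have ltx1 : x < x + 1 by rewrite ltrDl.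
have [dI eI] := @continuous_FTC1_closed _ f c x (x + 1) ltx1
  (continuous_integrable _ _ cf) cx (cf x).
have dF : is_derive x 1 (fun y => I c y - I c 0) (f x).
  have -> : f x = f x - 0 by rewrite subr0.
  apply: is_deriveB.
  by split; [exact: dI|rewrite -derive1E].
apply: near_eq_is_derive dF; near=> y; rewrite (FE c)//.
by rewrite ltW//; near: y; exact: lt_nbhsr.
Unshelve. all: by end_near. Qed.


(* A primitive of f is nondecreasing, hence constant when its increment
   vanishes. *)
Lemma Rintegral_eq0_oo f l : 0 < l -> continuous f ->
  (forall t, t \in `[0, l] -> 0 <= f t) -> \int[mu]_(t in `[0, l]) f t = 0 ->
  forall t, t \in `]0, l[ -> f t = 0.
Proof.
move=> l0 cf f0 If0 t tl.
have [F [F0 dF]] := continuous_primitive cf.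
have cF := is_derive_continuous dF.
have Fl : F l = 0 by rewrite (Rintegral_is_derive l0 cf dF) F0 subr0 in If0.
have mF x y : 0 <= x -> x <= y -> y <= l -> F x <= F y.
  apply: ger0_derive1_ndecr => //.
  - by move=> z zl; rewrite derive1E derive_val f0// (subset_itv_oo_cc zl).
  - exact: continuous_subspaceT.
have FE x : x \in `]0, l[ -> F x = 0.
  rewrite in_itv/= => /andP[x0 xl]; apply/eqP; rewrite eq_le.
  apply/andP; split; first by rewrite -[leRHS]Fl mF// ltW.
  by rewrite -[leLHS]F0 mF// ltW.
have : is_derive t 1 (cst (0 : R)) (f t).
  apply: (near_eq_is_derive _ (dF t)); near=> y; rewrite FE//.
  by near: y; exact: near_in_itvoo.
by move=> [_ <-]; rewrite derive_cst.
Unshelve. all: by end_near. Qed.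

Lemma is_derive_eq0 F f a b : a <= b -> continuous f ->
  (forall t, is_derive t 1 F (f t)) -> (forall t, t \in `[a, b] -> f t = 0) ->
  F a = F b.
Proof.
rewrite le_eqVlt => /predU1P[->//|ab] cf dF f0.
apply/eqP; rewrite eq_sym -subr_eq0 -(Rintegral_is_derive ab cf dF).
rewrite (@eq_Rintegral _ _ _ _ _ (cst 0)) ?Rintegral_cst ?mul0r//.
by move=> t /[!inE]/= tab; rewrite f0.
Qed.

(** At each end of the interval the two functions have the same one-sided limit, and limits are
    unique. *)
Lemma continuous_eq_cc f g a b : a < b -> continuous f -> continuous g ->
  {in `]a, b[, f =1 g} -> {in `[a, b], f =1 g}.
Proof.
move=> ab cf cg fg t.
have fga : f a = g a.
  apply: (@cvg_unique _ _ (f x @[x --> a^'+])) => //.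
    by apply: cvg_at_right_filter; exact: cf.
  have : g x @[x --> a^'+] --> g a by apply: cvg_at_right_filter; exact: cg.
  apply: cvg_trans; apply: near_eq_cvg; near=> x; rewrite fg// in_itv/=.
  by apply/andP; split.
have fgb : f b = g b.
  apply: (@cvg_unique _ _ (f x @[x --> b^'-])) => //.
    by apply: cvg_at_left_filter; exact: cf.
  have : g x @[x --> b^'-] --> g b by apply: cvg_at_left_filter; exact: cg.
  apply: cvg_trans; apply: near_eq_cvg; near=> x; rewrite fg// in_itv/=.
  by apply/andP; split.
rewrite in_itv/= => /andP[]; rewrite le_eqVlt => /predU1P[<-//|at_].
by rewrite le_eqVlt => /predU1P[->//|tb]; rewrite fg// in_itv/= at_.
Unshelve. all: by end_near. Qed.

Lemma contD f g : continuous f -> continuous g ->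
  continuous (fun t => f t + g t).
Proof. by move=> cf cg t; exact: (@cvgD _ R^o) (cf t) (cg t). Qed.

Lemma contB f g : continuous f -> continuous g ->
  continuous (fun t => f t - g t).
Proof. by move=> cf cg t; exact: (@cvgB _ R^o) (cf t) (cg t). Qed.

Lemma contN f : continuous f -> continuous (fun t => - f t).
Proof. by move=> cf t; exact: (@cvgN _ R^o) (cf t). Qed.

Lemma contM f g : continuous f -> continuous g ->
  continuous (fun t => f t * g t).
Proof. by move=> cf cg t; exact: cvgM (cf t) (cg t). Qed.

Lemma contX f n : continuous f -> continuous (fun t => f t ^+ n).
Proof. by move=> cf t; exact: (continuous_comp (cf t) (@exprn_continuous _ n _)). Qed.

Lemma cont_cst (c : R) : continuous (fun _ : R => c).
Proof. by move=> t; exact: cst_continuous. Qed.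

Lemma cont_id : continuous (fun t : R => t).
Proof. by move=> t; exact: cvg_id. Qed.

Lemma eq_int f g a b : {in `[a, b], f =1 g} ->
  \int[mu]_(t in `[a, b]) f t = \int[mu]_(t in `[a, b]) g t.
Proof. by move=> fg; apply: eq_Rintegral => t /[!inE]/=; exact: fg. Qed.

Lemma intD f g a b : continuous f -> continuous g ->
  \int[mu]_(t in `[a, b]) (f t + g t) =
  \int[mu]_(t in `[a, b]) f t + \int[mu]_(t in `[a, b]) g t.
Proof. by move=> cf cg; rewrite RintegralD//; exact: continuous_integrable. Qed.

Lemma intB f g a b : continuous f -> continuous g ->
  \int[mu]_(t in `[a, b]) (f t - g t) =
  \int[mu]_(t in `[a, b]) f t - \int[mu]_(t in `[a, b]) g t.
Proof. by move=> cf cg; rewrite RintegralB//; exact: continuous_integrable. Qed.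

Lemma intZ (c : R) f a b : continuous f ->
  \int[mu]_(t in `[a, b]) (c * f t) = c * \int[mu]_(t in `[a, b]) f t.
Proof. by move=> cf; rewrite RintegralZl//; exact: continuous_integrable. Qed.

Lemma int0 a b : \int[mu]_(t in `[a, b]) 0 = 0.
Proof. by rewrite Rintegral_cst ?mul0r. Qed.

End Calculus.

Ltac cont := lazymatch goal with
  | |- continuous (fun t => @?f t * @?g t) => apply: (@contM _ f g); cont
  | |- continuous (fun t => @?f t - @?g t) => apply: (@contB _ f g); cont
  | |- continuous (fun t => @?f t + @?g t) => apply: (@contD _ f g); cont
  | |- continuous (fun t => - @?f t) => apply: (@contN _ f); cont
  | |- continuous (fun t => @?f t ^+ ?n) => apply: (@contX _ f n); cont
  | _ => first [exact: cont_cst | exact: cont_id | eassumption]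
  end.

(** * Regularity of weak solutions *)

Section Regularity.
Context {R : realType}.
Implicit Types (f g h F G : R -> R) (a b l x t : R).
Local Notation mu := (@lebesgue_measure R).

(** [F] is constant on either side of []a, b[]: on the left it equals [F 0], on the right [F l],
    which is the vanishing integral of [f]. *)
Lemma bump_primitive F f a b l : 0 < a -> a < b -> b < l -> continuous f ->
  (forall t, t \notin `]a, b[ -> f t = 0) ->
  F 0 = 0 -> (forall t, is_derive t 1 F (f t)) ->
  \int[mu]_(t in `[0, l]) f t = 0 ->
  forall t, t \notin `]a, b[ -> F t = 0.
Proof.
move=> a0 ab bl cf f0 F0 dF If t; rewrite in_itv/= negb_and -!leNgt.
have l0 : 0 < l by lra.
have Fl : F l = 0 by rewrite (Rintegral_is_derive l0 cf dF) F0 subr0 in If.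
have Fa x : x <= a -> F x = F a.
  move=> xa; apply: (is_derive_eq0 xa cf dF) => y.
  by rewrite in_itv/= => /andP[_ ya]; apply: f0; rewrite in_itv/= negb_and -!leNgt ya.
have Fb x : b <= x -> F b = F x.
  move=> bx; apply: (is_derive_eq0 bx cf dF) => y.
  rewrite in_itv/= => /andP[yb _]; apply: f0.
  by rewrite in_itv/= negb_and -!leNgt yb orbT.
case/orP => [ta|bt]; first by rewrite Fa// -(Fa 0) ?ltW.
by rewrite -Fb// (Fb l) ?ltW.
Qed.

(** The weak form of h'' = 0 on []0, l[], tested against C^2 functions with compact support in the
    open interval. *)
Definition annihilates_second_derivatives l h :=
  forall phi phi1 phi2 : R -> R,
    (forall t, is_derive t 1 phi (phi1 t)) ->
    (forall t, is_derive t 1 phi1 (phi2 t)) -> continuous phi2 ->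
    (exists a b, [/\ 0 < a, b < l &
      forall t, t \notin `[a, b] -> phi t = 0 /\ phi1 t = 0]) ->
    \int[mu]_(t in `[0, l]) (h t * phi2 t) = 0.

(* The test function is the second primitive of k w, where the weight w is
   supported in [a, b] and k is the remainder of the w-orthogonal projection
   of h onto the affine functions; testing h then gives that k^2 w has
   integral 0. *)
Lemma annihilator_affine_on h l a b : 0 < a -> a < b -> b < l ->
  continuous h -> annihilates_second_derivatives l h ->
  exists c d, forall t, t \in `]a, b[ -> h t = c + d * t.
Proof.
move=> a0 ab bl ch hphi; have l0 : 0 < l by lra.
pose w t : R := Num.max 0 ((t - a) * (b - t)).
have cw : continuous w.
  have cq : continuous (fun t => (t - a) * (b - t)) by cont.
  move=> t; apply: (@continuous_max _ _ (cst 0) (fun t => (t - a) * (b - t))).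
    exact: cst_continuous.
  exact: cq.
have w_ge0 t : 0 <= w t by rewrite le_max lexx.
have w_gt0 t : t \in `]a, b[ -> 0 < w t.
  rewrite in_itv/= => /andP[at_ tb]; rewrite lt_max; apply/orP; right.
  by rewrite mulr_gt0 ?subr_gt0.
have w_eq0 t : t \notin `]a, b[ -> w t = 0.
  rewrite in_itv/= negb_and -!leNgt => tab; apply/max_l.
  by case/orP: tab => ?; nra.
pose I f := \int[mu]_(t in `[0, l]) f t.
have subab t : t \in `]a, b[ -> t \in `]0, l[.
  by rewrite !in_itv/= => /andP[? ?]; apply/andP; split; lra.
have I_gt0 f x : continuous f -> (forall t, 0 <= f t) -> x \in `]a, b[ ->
    f x != 0 -> I f != 0.
  move=> cf f0 xab; apply: contra_neq => If0.
  by apply: (Rintegral_eq0_oo l0 cf _ If0); [move=> ? _; exact: f0|exact: subab].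
(* [m] is the mean of t for the weight [w], so that 1 and [p] form a [w]-orthogonal basis of the
   affine functions. *)
pose A0 := I w; pose A1 := I (fun t => t * w t); pose m := A1 / A0.
have mid_in : (a + b) / 2 \in `]a, b[ by rewrite in_itv/=; apply/andP; split; lra.
have A00 : A0 != 0 by apply: (I_gt0 _ _ cw w_ge0 mid_in); rewrite gt_eqF ?w_gt0.
pose p t := t - m.
have cp : continuous p by rewrite /p; cont.
pose B := I (fun t => p t ^+ 2 * w t).
have B0 : B != 0.
  have cB : continuous (fun t => p t ^+ 2 * w t) by cont.
  have B_ge0 t : 0 <= p t ^+ 2 * w t by rewrite mulr_ge0 ?sqr_ge0.
  (* [p] vanishes only at [m]; if that is the midpoint, the integrand is positive at another point
     of []a, b[]. *)
  have [pm|pm] := eqVneq (p ((a + b) / 2)) 0.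
    have xin : (a + b + b) / 3 \in `]a, b[.
      by rewrite in_itv/=; apply/andP; split; lra.
    apply: (I_gt0 _ _ cB B_ge0 xin).
    rewrite mulf_neq0 ?(gt_eqF (w_gt0 _ _))// expf_eq0/=.
    apply/eqP; move: pm; rewrite /p; lra.
  apply: (I_gt0 _ _ cB B_ge0 mid_in).
  by rewrite mulf_neq0 ?(gt_eqF (w_gt0 _ _))// expf_eq0.
have Ip : I (fun t => p t * w t) = 0.
  rewrite /I (@eq_int _ _ (fun t => t * w t - m * w t)); last first.
    by move=> t _; rewrite /p mulrBl.
  rewrite intB; [|by cont..].
  by rewrite intZ// -/(I w) -/A0 /m divfK ?subrr.
pose c := I (fun t => h t * w t) / A0.
pose d := I (fun t => h t * (p t * w t)) / B.
pose k t := h t - (c + d * p t).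
have ck : continuous k by rewrite /k; cont.
pose rho t := k t * w t.
have crho : continuous rho by rewrite /rho; cont.
have rho_eq0 t : t \notin `]a, b[ -> rho t = 0.
  by move=> tab; rewrite /rho w_eq0// mulr0.
have Irho : I rho = 0.
  rewrite /I (@eq_int _ _
    (fun t => h t * w t - (c * w t + d * (p t * w t)))); last first.
    by move=> t _; rewrite /rho /k; ring.
  rewrite intB; [|by cont..].
  rewrite intD; [|by cont..].
  rewrite !intZ; [|by cont..].
  by rewrite -!/(I _) Ip mulr0 addr0 -/A0 /c divfK ?subrr.
have Iprho : I (fun t => p t * rho t) = 0.
  rewrite /I (@eq_int _ _
    (fun t => h t * (p t * w t) - (c * (p t * w t) + d * (p t ^+ 2 * w t))));
    last by move=> t _; rewrite /rho /k; ring.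
  rewrite intB; [|by cont..].
  rewrite intD; [|by cont..].
  rewrite !intZ; [|by cont..].
  by rewrite -!/(I _) Ip mulr0 add0r -/B /d divfK ?subrr.
have Itrho : I (fun t => t * rho t) = 0.
  rewrite /I (@eq_int _ _ (fun t => p t * rho t + m * rho t));
    last by move=> t _; rewrite /p; ring.
  rewrite intD; [|by cont..].
  rewrite intZ; last by cont.
  by rewrite -!/(I _) Irho Iprho mulr0 addr0.
(* The moments of [rho] of orders 0 and 1 vanish, so its first and second primitives both vanish
   outside []a, b[] and the second one is an admissible test function. *)
have [P1 [P10 dP1]] := continuous_primitive crho.
have cP1 := is_derive_continuous dP1.
have P1_eq0 := bump_primitive a0 ab bl crho rho_eq0 P10 dP1 Irho.
have l_notin : l \notin `]a, b[ by rewrite in_itv/= negb_and -!leNgt (ltW bl) orbT.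
have IP1 : I P1 = 0.
  have := Rintegral_by_parts l0 crho (@cont_cst _ 1) dP1 (fun t => is_derive_id t 1).
  rewrite P1_eq0// P10 !mul0r subrr sub0r => E.
  rewrite /I; transitivity (- I (fun t => t * rho t)).
    rewrite (@eq_int _ _ (fun t => P1 t * 1)).
      rewrite E; congr (- _); apply: eq_int => t _; exact: mulrC.
    by move=> t _; rewrite mulr1.
  by rewrite Itrho oppr0.
have [P2 [P20 dP2]] := continuous_primitive cP1.
have P2_eq0 := bump_primitive a0 ab bl cP1 P1_eq0 P20 dP2 IP1.
have Ihrho : I (fun t => h t * rho t) = 0.
  apply: (hphi P2 P1 rho) => //; exists a, b; split=> // t tab.
  have {}tab : t \notin `]a, b[ by apply: contra tab; exact: subset_itv_oo_cc.
  by rewrite P1_eq0 ?P2_eq0.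
(* [k] differs from [h] by an affine function, which integrates to 0 against [rho]. *)
have Ikrho : I (fun t => k t ^+ 2 * w t) = 0.
  rewrite /I (@eq_int _ _
    (fun t => h t * rho t - (c * rho t + d * (p t * rho t))));
    last by move=> t _; rewrite /rho /k; ring.
  rewrite intB; [|by cont..].
  rewrite intD; [|by cont..].
  rewrite !intZ; [|by cont..].
  by rewrite -!/(I _) Irho Iprho Ihrho !mulr0 addr0 subrr.
exists (c - d * m), d => t tab.
have : k t ^+ 2 * w t = 0.
  apply: (Rintegral_eq0_oo l0 _ _ Ikrho); [by cont| |exact: subab].
  by move=> x _; rewrite mulr_ge0 ?sqr_ge0.
move/eqP; rewrite mulf_eq0 (gt_eqF (w_gt0 _ tab)) orbF sqrf_eq0 => /eqP.
by rewrite /k /p => kt; lra.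
Qed.

(** Any interior point lies with l / 3 and 2 l / 3 in a common subinterval on which [h] is affine.
    The values at these two fixed points determine the coefficients once and for all, and continuity
    adds the ends. *)
Lemma annihilator_affine h l : 0 < l -> continuous h ->
  annihilates_second_derivatives l h ->
  exists c d, {in `[0, l], forall t, h t = c + d * t}.
Proof.
move=> l0 ch hphi.
pose d := (h (2 * l / 3) - h (l / 3)) / (l / 3); pose c := h (l / 3) - d * (l / 3).
exists c, d.
apply: (continuous_eq_cc l0 ch); first by cont.
move=> t; rewrite in_itv/= => /andP[t0 tl].
pose a := Num.min (l / 3) t / 2; pose b := (Num.max (2 * l / 3) t + l) / 2.
have a0 : 0 < a by rewrite divr_gt0// lt_min t0 andbT; lra.
have al : a < l / 3.
  by have : Num.min (l / 3) t <= l / 3 by [rewrite ge_min lexx]; rewrite /a; lra.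
have at_ : a < t.
  by have : Num.min (l / 3) t <= t by [rewrite ge_min lexx orbT]; rewrite /a in a0 *; lra.
have mb : Num.max (2 * l / 3) t < l by rewrite gt_max tl andbT; lra.
have lb : 2 * l / 3 < b.
  have : 2 * l / 3 <= Num.max (2 * l / 3) t by rewrite le_max lexx.
  by rewrite /b; lra.
have tb : t < b.
  have : t <= Num.max (2 * l / 3) t by rewrite le_max lexx orbT.
  by rewrite /b; lra.
have bl : b < l by rewrite /b; lra.
have ab : a < b by lra.
have [c' [d' E]] := annihilator_affine_on a0 ab bl ch hphi.
have in_ab x : a < x -> x < b -> h x = c' + d' * x.
  by move=> ax xb; apply: E; rewrite in_itv/= ax.
rewrite /c /d (in_ab t)// (in_ab (l / 3)); [|lra..].
rewrite (in_ab (2 * l / 3)); [|lra..].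
by field; rewrite gt_eqF.
Qed.

Lemma test_function_is_derive l (phi phi1 : R -> R) :
  (forall t, is_derive t 1 phi (phi1 t)) -> continuous phi1 ->
  (exists a b, [/\ 0 < a, b < l & forall t, t \notin `[a, b] -> phi t = 0]) ->
  test_function l phi.
Proof.
move=> dphi cphi1 supp; split => //.
by rewrite (is_derive_derive1 dphi).
Qed.

(** A second primitive [G] of [g] has the same weak second derivative as [f], so f - G annihilates
    second derivatives and is affine; [F] is [G] plus this affine function. *)
Lemma weak_second_derivative_regular f g l : 0 < l ->
  {within `[0, l], continuous f} -> continuous g ->
  H2_with_second_derivative l f g ->
  exists F F1, [/\ {in `[0, l], f =1 F}, forall t, is_derive t 1 F (F1 t)
                 & forall t, is_derive t 1 F1 (g t)].
Proof.
move=> l0 cf cg [f1 [_ _ _ ff1 f1g]].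
have [G1 [_ dG1]] := continuous_primitive cg.
have cG1 := is_derive_continuous dG1.
have [G [_ dG]] := continuous_primitive cG1.
have cG := is_derive_continuous dG.
pose h t := f (clamp l t) - G t.
have cfl := continuous_clamp (ltW l0) cf.
have ch : continuous h.
  have ? : continuous (fun t => f (clamp l t)) by exact: cfl.
  by rewrite /h; cont.
have [|c [d hE]] := annihilator_affine l0 ch.
  move=> phi phi1 phi2 dphi dphi1 cphi2 [a [b [a0 bl supp]]].
  have cphi1 := is_derive_continuous dphi1.
  have cphi := is_derive_continuous dphi.
  have tphi : test_function l phi.
    apply: (test_function_is_derive dphi) => //.
    by exists a, b; split=> // t /supp[].
  have tphi1 : test_function l phi1.
    apply: (test_function_is_derive dphi1) => //.
    by exists a, b; split=> // t /supp[].
  have phi0 : phi 0 = 0.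
    by apply: (supp 0 _).1; rewrite in_itv/= negb_and -!ltNge a0.
  have phi10 : phi1 0 = 0.
    by apply: (supp 0 _).2; rewrite in_itv/= negb_and -!ltNge a0.
  have phil : phi l = 0.
    by apply: (supp l _).1; rewrite in_itv/= negb_and -!ltNge bl orbT.
  have phi1l : phi1 l = 0.
    by apply: (supp l _).2; rewrite in_itv/= negb_and -!ltNge bl orbT.
  have := ff1 _ tphi1; rewrite (is_derive_derive1 dphi1) => E1.
  have := f1g _ tphi; rewrite (is_derive_derive1 dphi) => E2.
  have E3 := Rintegral_by_parts l0 cG1 cphi2 dG dphi1.
  have E4 := Rintegral_by_parts l0 cg cphi1 dG1 dphi.
  rewrite phi10 phi1l !mulr0 subr0 sub0r in E3.
  rewrite phi0 phil !mulr0 subr0 sub0r in E4.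
  rewrite (@eq_int _ _
    (fun t => f (clamp l t) * phi2 t - G t * phi2 t)); last first.
    by move=> t _; rewrite /h mulrBl.
  rewrite intB; [|by apply: contM..].
  rewrite (@eq_int _ _ (fun t => f t * phi2 t)); last first.
    by move=> t /[!inE]/= tl; rewrite clamp_id.
  by rewrite E1 E2 E3 E4 !opprK subrr.
exists (fun t => G t + (c + d * t)), (fun t => G1 t + d); split.
- move=> t tl; have := hE t tl; rewrite /h clamp_id//; lra.
- move=> t; have -> : G1 t + d = G1 t + (0 + d * 1) by rewrite add0r mulr1.
  exact: is_deriveD.
- move=> t; have -> : g t = g t + 0 by rewrite addr0.
  exact: is_deriveD.
Qed.

End Regularity.

(** * Gaussian laws *)

Section GaussianLaw.
Context {R : realType}.
Local Notation mu := (@lebesgue_measure R).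
Implicit Types (c s v x : R).

(** The Radon-Nikodym derivative of the normal law and its density have the same integral over every
    measurable set, hence agree almost everywhere. *)
Lemma integral_normal_prob (m s : R) (f : R -> \bar R) :
  (normal_prob m s).-integrable setT f ->
  (\int[normal_prob m s]_x f x = \int[mu]_x (f x * (normal_pdf m s x)%:E))%E.
Proof.
move=> fi; have mf := measurable_int _ fi.
rewrite -(Radon_Nikodym_change_of_variables (normal_prob_dominates m s))//=.
have RNi : mu.-integrable setT
    (Radon_Nikodym (charge_of_finite_measure (normal_prob m s)) mu).
  by apply: Radon_Nikodym_integrable; exact: normal_prob_dominates.
apply: ae_eq_integral => //.
- by apply: emeasurable_funM => //; exact: measurable_int RNi.
- by apply: emeasurable_funM => //; apply/measurable_EFinP; exact: measurable_normal_pdf.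
- apply: ae_eqe_mul2l => /=.
  rewrite Radon_NikodymE//=; first exact: normal_prob_dominates.
  move=> dom; case: cid => /= h [h1 h2 h3].
  apply: integral_ae_eq => //=.
  + by apply/measurable_EFinP; exact: measurable_normal_pdf.
  + by move=> E _ mE; rewrite -h3.
Qed.

(** Adding c to 1 / (2 s^2) divides the variance by q = 1 + 2 c s^2; the factor in front compensates
    for the changed normalization. *)
Lemma expR_sqr_normal_pdf c s x : 0 <= c -> 0 < s ->
  expR (- (c * x ^+ 2)) * normal_pdf 0 s x =
  (Num.sqrt (1 + 2 * c * s ^+ 2))^-1 *
  normal_pdf 0 (s / Num.sqrt (1 + 2 * c * s ^+ 2)) x.
Proof.
move=> c0 s0; set q := 1 + _.
have q0 : 0 < q by rewrite /q ltr_pwDl// !mulr_ge0// ltW// exprn_gt0.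
have sq0 : 0 < Num.sqrt q by rewrite sqrtr_gt0.
have r0 : s / Num.sqrt q != 0 by rewrite mulf_neq0 ?invr_neq0 ?gt_eqF.
rewrite !normal_pdfE ?(gt_eqF s0)//.
rewrite mulrCA [RHS]mulrA; congr (_ * _); last first.
  rewrite /normal_fun -expRD; congr expR.
  rewrite expr_div_n sqr_sqrtr ?ltW// /q subr0.
  by field; rewrite ?gt_eqF//=.
rewrite /normal_peak expr_div_n sqr_sqrtr ?ltW//.
rewrite [in RHS](_ : _ *+ 2 = (s ^+ 2 * pi *+ 2) / q); last by ring.
rewrite sqrtrM; last by rewrite mulrn_wge0// mulr_ge0 ?sqr_ge0 ?pi_ge0.
by rewrite sqrtrV ?ltW// invfM invrK mulrCA mulVf ?mulr1// gt_eqF.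
Qed.

Lemma integrable_expR_sqr (d : measure_display) (T : measurableType d)
    (P : probability T R) (X : T -> R) c : 0 <= c -> measurable_fun setT X ->
  P.-integrable setT (EFin \o (fun w => expR (- (c * X w ^+ 2)))).
Proof.
move=> c0 mX; apply: measurable_bounded_integrable => //.
- by rewrite (le_lt_trans (probability_le1 _ _))// ltry.
- apply: measurableT_comp => //; apply: measurableT_comp => //.
  by apply: measurable_funM => //; exact: measurable_funX.
- exists 1; split => // y y1 w _ /=.
  rewrite ger0_norm ?expR_ge0// (le_trans _ (ltW y1))// -expR0 ler_expR.
  by rewrite oppr_le0 mulr_ge0 ?sqr_ge0.
Qed.

(** The Laplace transform of X^2: under the law of [X] the integrand times the density is a multiple
    of another normal density. Variance 0, a point mass, is treated apart. *)
Lemma normal_law_expR_sqr (d : measure_display) (T : measurableType d)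
    (P : probability T R) (X : T -> R) v c :
  measurable_fun setT X -> normal_law P X 0 v -> 0 <= c ->
  (\int[P]_w (expR (- (c * X w ^+ 2)))%:E =
   ((Num.sqrt (1 + 2 * c * v))^-1)%:E)%E.
Proof.
move=> mX [v0 lawX] c0.
pose f (x : measurableTypeR R) := (expR (- (c * x ^+ 2)))%:E.
have mf : measurable_fun setT f.
  apply/measurable_EFinP; apply: measurableT_comp => //.
  apply: measurableT_comp => //.
  by apply: measurable_funM => //; exact: measurable_funX.
have f0 x : (0 <= f x)%E by rewrite lee_fin expR_ge0.
transitivity (\int[pushforward P (X : T -> measurableTypeR R)]_x f x)%E.
  by rewrite ge0_integral_pushforward// => x _; exact: f0.
have [v_eq0|v_neq0] := eqVneq v 0.
  transitivity (\int[\d_((0%R : R) : measurableTypeR R)]_x f x)%E.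
    apply: eq_measure_integral => A mA _.
    by have := lawX A mA; rewrite v_eq0 eqxx.
  rewrite integral_dirac//= diracT mul1e /f expr0n/= mulr0 oppr0 expR0.
  by rewrite v_eq0 mulr0 addr0 sqrtr1 invr1.
have sv0 : 0 < Num.sqrt v by rewrite sqrtr_gt0 lt_neqAle eq_sym v_neq0.
transitivity (\int[normal_prob 0 (Num.sqrt v)]_x f x)%E.
  apply: eq_measure_integral => A mA _.
  by have := lawX A mA; rewrite (negbTE v_neq0).
rewrite integral_normal_prob; last first.
  exact: (@integrable_expR_sqr _ (measurableTypeR R) (normal_prob 0 (Num.sqrt v))
            (fun x => x) c c0 (@measurable_id _ _ _)).
under eq_integral.
  move=> x _; rewrite -EFinM expR_sqr_normal_pdf// sqr_sqrtr// EFinM; over.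
by rewrite integralZl// ?integral_normal_pdf ?mule1//; exact: integrable_normal_pdf.
Qed.

(** With c = 1 / (n + 1) and q = (1 + 2 c v)^(1/2), the relation q^2 - 1 = 2 c v rewrites the
    quotient as 2 v / (q (q + 1)), and q tends to 1. *)
Lemma cvg_invrS_sqrt (v : R) : 0 <= v ->
  (fun n => (1 - (Num.sqrt (1 + 2 * n.+1%:R^-1 * v))^-1) / n.+1%:R^-1)
    @ \oo --> v.
Proof.
move=> v0.
pose q (n : nat) := Num.sqrt (1 + 2 * n.+1%:R^-1 * v).
have q2 n : q n ^+ 2 = 1 + 2 * n.+1%:R^-1 * v.
  by rewrite sqr_sqrtr// addr_ge0// !mulr_ge0// invr_ge0.
have q1 n : 0 < q n by rewrite sqrtr_gt0 ltr_pwDl// !mulr_ge0// invr_ge0.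
have cq : q @ \oo --> (1 : R).
  have -> : 1 = Num.sqrt (1 + 2 * 0 * v) by rewrite mulr0 mul0r addr0 sqrtr1.
  apply: (continuous_cvg _ (@sqrt_continuous _ _)).
  apply: (@cvgD _ R^o); first exact: cvg_cst.
  apply: cvgMr_tmp; apply: cvgMl_tmp; exact: cvg_harmonic.
have E : (fun n => (1 - (q n)^-1) / n.+1%:R^-1) =
    (fun n => 2 * v / (q n * (q n + 1))).
  apply/funext => n.
  have n0 : n.+1%:R^-1 != 0 :> R by rewrite invr_eq0 pnatr_eq0.
  have qn0 : q n != 0 by rewrite gt_eqF.
  have qn1 : q n + 1 != 0 by rewrite gt_eqF// addr_gt0.
  have qe : 2 * v = (q n ^+ 2 - 1) / n.+1%:R^-1 by rewrite q2; field.
  by rewrite qe; move: (n.+1%:R^-1) n0 => k k0; field; rewrite qn0 qn1 k0.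
have e2 : 2 * v / (1 * (1 + 1)) = v by field.
rewrite E; suff h : (fun n => 2 * v / (q n * (q n + 1))) @ \oo -->
    2 * v / (1 * (1 + 1)) by rewrite e2 in h; exact: h.
apply: cvgMl_tmp; apply: cvgV; first by rewrite mul1r gt_eqF.
apply: cvgM => //; apply: (@cvgD _ R^o) => //; exact: cvg_cst.
Qed.

(** With a = 1 / (n + 1), the quotient lies between y / (1 + a y) and y; both bounds follow from 1 +
    x <= exp x. *)
Lemma cvg_expR_harmonic (y : R) : 0 <= y ->
  (fun n => (1 - expR (- (n.+1%:R^-1 * y))) / n.+1%:R^-1) @ \oo --> y.
Proof.
move=> y0.
have n0 (n : nat) : 0 < n.+1%:R^-1 :> R by rewrite invr_gt0.
apply: (@squeeze_cvgr _ _ _ _ (fun n : nat => y / (1 + n.+1%:R^-1 * y)) (cst y)).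
- near=> n; have := n0 n; set a := n.+1%:R^-1 => a0; apply/andP; split.
    rewrite ler_pdivlMr//.
    have e0 : 0 < 1 + a * y by rewrite ltr_pwDl// mulr_ge0// ltW.
    rewrite mulrAC ler_pdivrMr// mulrBl mul1r.
    have : expR (- (a * y)) * (1 + a * y) <= 1.
      rewrite expRN -ler_pdivlMl ?invr_gt0 ?expR_gt0// invrK mulr1.
      exact: expR_ge1Dx.
    by lra.
  rewrite ler_pdivrMr//.
  by have := expR_ge1Dx (- (a * y)); rewrite /cst; lra.
- have e1 : y / (1 + 0 * y) = y by rewrite mul0r addr0 divr1.
  suff h : (fun n : nat => y / (1 + n.+1%:R^-1 * y)) @ \oo --> y / (1 + 0 * y).
    by rewrite e1 in h; exact: h.
  apply: cvgMl_tmp; apply: cvgV; first by rewrite mul0r addr0 oner_neq0.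
  apply: (@cvgD _ R^o); first exact: cvg_cst.
  by apply: cvgMr_tmp; exact: cvg_harmonic.
- exact: cvg_cst.
Unshelve. all: by end_near. Qed.

(* Differentiating the Laplace transform of X^2 at 0. *)
Lemma normal_law_second_moment (d : measure_display) (T : measurableType d)
    (P : probability T R) (X : T -> R) v e :
  measurable_fun setT X -> normal_law P X 0 v ->
  (\int[P]_w (X w ^+ 2)%:E = e%:E)%E -> v = e.
Proof.
move=> mX lawX X2.
have v0 := lawX.1.
pose f (n : nat) (w : T) := ((1 - expR (- (n.+1%:R^-1 * X w ^+ 2))) / n.+1%:R^-1)%:E.
have n0 (n : nat) : 0 < n.+1%:R^-1 :> R by rewrite invr_gt0.
have iexp n := integrable_expR_sqr P (ltW (n0 n)) mX.
have If n : (\int[P]_w f n w =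
    ((1 - (Num.sqrt (1 + 2 * n.+1%:R^-1 * v))^-1) / n.+1%:R^-1)%:E)%E.
  have i1 : P.-integrable setT (EFin \o cst (1 : R)).
    exact: finite_measure_integrable_cst.
  rewrite /f; under eq_integral do rewrite EFinM EFinB.
  rewrite integralZr//; last exact: (integrableB _ i1 (iexp n)).
  rewrite integralB_EFin//= (normal_law_expR_sqr mX lawX (ltW (n0 n))).
  by rewrite integral_cst//= mul1e probability_setT -EFinB -EFinM.
have mX2 : measurable_fun setT (fun w => (X w ^+ 2)%:E).
  by apply/measurable_EFinP; exact: measurable_funX.
(* The difference quotients tend to X^2 and are dominated by X^2 itself, because 1 - exp(-y) <=
   y. *)
have [] := @dominated_convergence _ _ _ P setT measurableT f
  (fun w => (X w ^+ 2)%:E) (fun w => (X w ^+ 2)%:E).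
- move=> n; apply/measurable_EFinP; apply: measurable_funM => //.
  apply: measurable_funB => //; apply/measurable_EFinP.
  exact: measurable_int (iexp n).
- exact: mX2.
- apply: aeW => w _; apply: cvg_EFin; first by near=> n.
  exact: (cvg_expR_harmonic (sqr_ge0 (X w))).
- apply/integrableP; split => //.
  under eq_integral => w _ do rewrite gee0_abs ?lee_fin ?sqr_ge0//.
  by rewrite X2 ltry.
- apply: aeW => w n _; rewrite /f gee0_abs lee_fin.
    have := n0 n; set a := n.+1%:R^-1 => a0; rewrite ler_pdivrMr//.
    by have := expR_ge1Dx (- (a * X w ^+ 2)); lra.
  rewrite mulr_ge0 ?invr_ge0// subr_ge0 -expR0 ler_expR oppr_le0.
  by rewrite mulr_ge0 ?sqr_ge0// ltW.
move=> _ _; rewrite X2; under eq_fun do rewrite If.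
move/fine_cvgP => [_] /= cv; apply: (cvg_unique _ (cvg_invrS_sqrt v0) cv).
Unshelve. all: by end_near. Qed.

(** The means of the bounded function exp(-x^2) converge along the sequence, and they determine the
    variance because (1 + 2 v)^(-1/2) is injective in v >= 0. *)
Lemma normal_law_cvg_variance (d : measure_display) (T : measurableType d)
    (P : probability T R) (Xn : nat -> T -> R) (X : T -> R) (vn : nat -> R) v s :
  (forall n, measurable_fun setT (Xn n)) -> measurable_fun setT X ->
  (forall n, normal_law P (Xn n) 0 (vn n)) -> normal_law P X 0 v ->
  {ae P, forall w, Xn ^~ w @ \oo --> X w} ->
  vn @ \oo --> s -> v = s.
Proof.
move=> mXn mX lawn law cvX cvs.
have v0 := law.1.
have s0 : 0 <= s.
  rewrite -(cvg_lim _ cvs)//; apply: limr_ge; first by apply/cvg_ex; exists s.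
  by near=> n; exact: (lawn n).1.
pose g (X : T -> R) w := (expR (- (1 * X w ^+ 2)))%:E.
have ig Y : measurable_fun setT Y -> P.-integrable setT (g Y).
  by move=> mY; exact: (integrable_expR_sqr P ler01 mY).
have Ig Y t : measurable_fun setT Y -> normal_law P Y 0 t ->
    (\int[P]_w g Y w = ((Num.sqrt (1 + 2 * 1 * t))^-1)%:E)%E.
  by move=> mY lY; exact: (normal_law_expR_sqr mY lY ler01).
have [] := @dominated_convergence _ _ _ P setT measurableT (fun n => g (Xn n))
  (g X) (cst 1%E).
- by move=> n; exact: measurable_int (ig _ (mXn n)).
- exact: measurable_int (ig _ mX).
- apply: filterS cvX => w cvw _; apply: cvg_EFin; first by near=> n.
  apply: (continuous_cvg _ (@continuous_expR _ _)).
  apply: (@cvgN _ R^o); apply: cvgMl_tmp.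
  exact: (cvg_comp _ _ cvw (@exprn_continuous _ 2 (X w))).
- exact: finite_measure_integrable_cst.
- apply: aeW => w n _; rewrite /g gee0_abs lee_fin ?expR_ge0//.
  by rewrite -expR0 ler_expR oppr_le0 mulr_ge0 ?sqr_ge0.
move=> _ _ cvI.
have IE : (fun n => \int[P]_w g (Xn n) w)%E =
    (fun n => ((Num.sqrt (1 + 2 * 1 * vn n))^-1)%:E).
  by apply/funext => n; rewrite (Ig _ _ (mXn n) (lawn n)).
have := cvI : (fun n => \int[P]_w g (Xn n) w)%E @ \oo --> (\int[P]_w g X w)%E.
rewrite IE (Ig X v mX law) => /fine_cvgP[_] /= cv.
have q0 (t : R) : 0 <= t -> 0 < 1 + 2 * 1 * t.
  by move=> t0; rewrite ltr_pwDl// !mulr_ge0.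
have cs : (fun n => (Num.sqrt (1 + 2 * 1 * vn n))^-1) @ \oo -->
    (Num.sqrt (1 + 2 * 1 * s))^-1.
  apply: cvgV; first by rewrite gt_eqF// sqrtr_gt0 q0.
  apply: (continuous_cvg _ (@sqrt_continuous _ _)).
  by apply: (@cvgD _ R^o); [exact: cvg_cst|exact: cvgMl_tmp].
have E : (Num.sqrt (1 + 2 * 1 * v))^-1 = (Num.sqrt (1 + 2 * 1 * s))^-1.
  exact: (cvg_unique _ cv cs).
move/invr_inj/eqP : E.
rewrite eqr_sqrt ?ltW ?q0// => /eqP; lra.
Unshelve. all: by end_near. Qed.

End GaussianLaw.

(** * Square-integrable functions on the graph *)

Lemma cvgn_eq (R : realType) (u : nat -> R) (a b : R) :
  u @ \oo --> a -> a = b -> u @ \oo --> b.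
Proof. by move=> ua <-. Qed.

Section L2.
Context {R : realType} {G : metric_graph R}.
Local Notation mu := (@lebesgue_measure R).
Implicit Types (f g : R -> R) (l c : R) (psi chi : edge G -> R -> R).

Lemma L2_itv_integrable_mul l f g : L2_itv l f -> L2_itv l g ->
  mu.-integrable `[0, l] (EFin \o (fun t => f t * g t)).
Proof.
move=> [mf f2] [mg g2].
have fg2 : mu.-integrable `[0, l] (EFin \o (fun t => f t ^+ 2 + g t ^+ 2)).
  have := integrableD _ f2 g2; rewrite /= => /(_ (measurable_itv _)).
  by apply: eq_integrable.
apply: le_integrable fg2 => //.
  by apply/measurable_EFinP; exact: measurable_funM.
move=> t _ /=; rewrite lee_fin [leRHS]ger0_norm ?addr_ge0 ?sqr_ge0// normrM.
have := sqr_ge0 (`|f t| - `|g t|); have := sqr_ge0 (`|f t|); have := sqr_ge0 (`|g t|).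
by rewrite -(real_normK (num_real (f t))) -(real_normK (num_real (g t))); nra.
Qed.

Lemma L2_itvD l f g : L2_itv l f -> L2_itv l g -> L2_itv l (fun t => f t + g t).
Proof.
move=> Lf Lg; have [mf f2] := Lf; have [mg g2] := Lg.
have fg := L2_itv_integrable_mul Lf Lg.
split; first exact: measurable_funD.
have := integrableD _ (integrableD _ f2 g2) (integrableD _ fg fg).
move=> /(_ (measurable_itv _) (measurable_itv _) (measurable_itv _)).
by apply: eq_integrable => // t _ /=; rewrite -!EFinD; congr EFin; ring.
Qed.

Lemma L2_itvZ l c f : L2_itv l f -> L2_itv l (fun t => c * f t).
Proof.
move=> [mf f2]; split; first exact: measurable_funM.
have := integrableZl _ (c ^+ 2) f2 => /(_ (measurable_itv _)).
by apply: eq_integrable => // t _ /=; rewrite -EFinM exprMn.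
Qed.

Lemma L2_itv_continuous l f : continuous f -> L2_itv l f.
Proof.
move=> cf; split; last by apply: continuous_integrable; cont.
by apply: measurable_funTS; exact: continuous_measurable_fun.
Qed.

Lemma eq_L2_itv l f g : {in `[0, l], f =1 g} -> L2_itv l f -> L2_itv l g.
Proof.
move=> fg [mf f2]; split.
  by apply: eq_measurable_fun mf => t /[!inE]/=; exact: fg.
by apply: eq_integrable f2 => // t /[!inE]/= tl /=; rewrite fg.
Qed.

Lemma L2_graphD psi chi : L2_graph psi -> L2_graph chi ->
  L2_graph (fun e t => psi e t + chi e t).
Proof. by move=> Lp Lc e; exact: L2_itvD (Lp e) (Lc e). Qed.

Lemma L2_graphZ c psi : L2_graph psi -> L2_graph (fun e t => c * psi e t).
Proof. by move=> Lp e; exact: L2_itvZ (Lp e). Qed.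

Lemma L2_graphB psi chi : L2_graph psi -> L2_graph chi ->
  L2_graph (fun e t => psi e t - chi e t).
Proof.
move=> Lp Lc; have -> : (fun e t => psi e t - chi e t) =
    (fun e t => psi e t + -1 * chi e t).
  by apply/funext => e; apply/funext => t; rewrite mulN1r.
exact/L2_graphD/L2_graphZ.
Qed.

Lemma L2_graph_sum n (c : nat -> R) (phi : nat -> edge G -> R -> R) :
  (forall k, L2_graph (phi k)) ->
  L2_graph (fun e t => \sum_(k < n) c k * phi k e t).
Proof.
move=> Lphi; elim: n => [|n ih].
  have -> : (fun e t => \sum_(k < 0) c k * phi k e t) = (fun _ _ => 0).
    by apply/funext => e; apply/funext => t; rewrite big_ord0.
  by move=> e; apply: L2_itv_continuous; exact: cont_cst.
have -> : (fun e t => \sum_(k < n.+1) c k * phi k e t) =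
    (fun e t => \sum_(k < n) c k * phi k e t + c n * phi n e t).
  by apply/funext => e; apply/funext => t; rewrite big_ord_recr.
by apply: L2_graphD => //; exact: L2_graphZ.
Qed.

Lemma L2_innerC psi chi : L2_inner psi chi = L2_inner chi psi.
Proof.
apply: eq_bigr => e _; apply: eq_int => t _; exact: mulrC.
Qed.

Lemma L2_innerDl psi1 psi2 chi :
  L2_graph psi1 -> L2_graph psi2 -> L2_graph chi ->
  L2_inner (fun e t => psi1 e t + psi2 e t) chi =
  L2_inner psi1 chi + L2_inner psi2 chi.
Proof.
move=> L1 L2 Lc; rewrite /L2_inner -big_split/=; apply: eq_bigr => e _.
rewrite -RintegralD//; [|exact: L2_itv_integrable_mul..].
by apply: eq_int => t _; rewrite mulrDl.
Qed.

Lemma L2_innerZl c psi chi : L2_graph psi -> L2_graph chi ->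
  L2_inner (fun e t => c * psi e t) chi = c * L2_inner psi chi.
Proof.
move=> L1 Lc; rewrite /L2_inner mulr_sumr; apply: eq_bigr => e _.
rewrite -RintegralZl//; last exact: L2_itv_integrable_mul.
by apply: eq_int => t _; rewrite mulrA.
Qed.

Lemma L2_innerBl psi1 psi2 chi :
  L2_graph psi1 -> L2_graph psi2 -> L2_graph chi ->
  L2_inner (fun e t => psi1 e t - psi2 e t) chi =
  L2_inner psi1 chi - L2_inner psi2 chi.
Proof.
move=> L1 L2 Lc; rewrite /L2_inner -sumrB; apply: eq_bigr => e _.
rewrite -RintegralB//; [|exact: L2_itv_integrable_mul..].
by apply: eq_int => t _; rewrite mulrBl.
Qed.

Lemma L2_inner_ge0 psi : 0 <= L2_inner psi psi.
Proof.
by apply: sumr_ge0 => e _; apply: Rintegral_ge0 => t _; rewrite -expr2 sqr_ge0.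
Qed.

Lemma L2_inner_suml n (c : nat -> R) (phi : nat -> edge G -> R -> R) chi :
  (forall k, L2_graph (phi k)) -> L2_graph chi ->
  L2_inner (fun e t => \sum_(k < n) c k * phi k e t) chi =
  \sum_(k < n) c k * L2_inner (phi k) chi.
Proof.
move=> Lphi Lc; elim: n => [|n ih].
  rewrite big_ord0 /L2_inner big1// => e _.
  by rewrite (@eq_int _ _ (fun=> 0)) ?int0// => t _; rewrite big_ord0 mul0r.
have -> : (fun e t => \sum_(k < n.+1) c k * phi k e t) =
    (fun e t => \sum_(k < n) c k * phi k e t + c n * phi n e t).
  by apply/funext => e; apply/funext => t; rewrite big_ord_recr.
rewrite L2_innerDl ?big_ord_recr ?ih ?L2_innerZl//; last exact: L2_graphZ.
exact: L2_graph_sum.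
Qed.

Lemma L2_inner_CS psi chi : L2_graph psi -> L2_graph chi ->
  L2_inner psi chi ^+ 2 <= L2_inner psi psi * L2_inner chi chi.
Proof.
move=> Lp Lc.
have q (a b : R) : 0 <= a ^+ 2 * L2_inner psi psi + 2 * a * b * L2_inner psi chi
    + b ^+ 2 * L2_inner chi chi.
  have := L2_inner_ge0 (fun e t => a * psi e t + b * chi e t).
  have La := L2_graphZ a Lp; have Lb := L2_graphZ b Lc.
  have Lab := L2_graphD La Lb.
  rewrite L2_innerDl// !L2_innerZl// !(L2_innerC _ (fun e t => _ + _)).
  rewrite !L2_innerDl// !L2_innerZl// (L2_innerC chi psi).
  by move=> /le_trans; apply; rewrite le_eqVlt; apply/orP; left; apply/eqP; ring.
have p0 := L2_inner_ge0 psi; have c0 := L2_inner_ge0 chi.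
(* With a, b the squared norms and r the inner product, the form takes here the values b (a b - r^2)
   and, on the next line, a (a b - r^2), which settles the case of a nonzero norm. If a = b = 0, its
   value -2 r^2 at (1, -r) forces r = 0. *)
have := q (L2_inner chi chi) (- L2_inner psi chi).
have := q (- L2_inner psi chi) (L2_inner psi psi).
have := q 1 (- L2_inner psi chi); have := q 1 (L2_inner psi chi).
set a := L2_inner psi psi in p0 *; set b := L2_inner chi chi in c0 *.
set r := L2_inner psi chi => q1 q2 q3 q4.
have [a0|a0] := eqVneq a 0.
  have [b0|b0] := eqVneq b 0; first by rewrite a0 b0 in q1 q2 *; nra.
  have b1 : 0 < b by rewrite lt_neqAle eq_sym b0.
  rewrite -(ler_pM2r b1); rewrite a0 in q4 *; nra.
have a1 : 0 < a by rewrite lt_neqAle eq_sym a0.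
by rewrite -(ler_pM2r a1); nra.
Qed.

Lemma L2_cvg_inner (psis : nat -> edge G -> R -> R) psi chi :
  (forall n, L2_graph (psis n)) -> L2_graph psi -> L2_graph chi ->
  L2_cvg psis psi ->
  (fun n => L2_inner (psis n) chi) @ \oo --> L2_inner psi chi.
Proof.
move=> Ln Lp Lc cv; apply/subr_cvg0.
apply/norm_cvg0P.
pose D n := L2_inner (fun e t => psis n e t - psi e t) (fun e t => psis n e t - psi e t).
have sD : (fun n => Num.sqrt (D n * L2_inner chi chi)) @ \oo --> (0 : R).
  apply: (@cvgn_eq _ _ (Num.sqrt (0 * L2_inner chi chi))); last first.
    by rewrite mul0r sqrtr0.
  apply: (continuous_cvg _ (@sqrt_continuous _ _)).
  exact: cvgMr_tmp.
apply: (@squeeze_cvgr _ _ _ _ (cst 0) (fun n => Num.sqrt (D n * L2_inner chi chi))) => //;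
  last exact: cvg_cst.
near=> n; rewrite normr_ge0/= -L2_innerBl//.
rewrite -sqrtr_sqr; apply: ler_wsqrtr; apply: L2_inner_CS => //.
exact: L2_graphB.
Unshelve. all: by end_near. Qed.

(** Expand |psi_n|^2 = |psi_n - psi|^2 + 2 (psi_n, psi) - |psi|^2 and use weak convergence for the
    middle term. *)
Lemma L2_cvg_norm (psis : nat -> edge G -> R -> R) psi :
  (forall n, L2_graph (psis n)) -> L2_graph psi -> L2_cvg psis psi ->
  (fun n => L2_inner (psis n) (psis n)) @ \oo --> L2_inner psi psi.
Proof.
move=> Ln Lp cv; have c1 := L2_cvg_inner Ln Lp Lp cv.
have -> : (fun n => L2_inner (psis n) (psis n)) = (fun n =>
    L2_inner (fun e t => psis n e t - psi e t) (fun e t => psis n e t - psi e t)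
    + (2 * L2_inner (psis n) psi - L2_inner psi psi)).
  apply/funext => n; have LB := L2_graphB (Ln n) Lp.
  rewrite L2_innerBl// !(L2_innerC _ (fun e t => _ - _)) !L2_innerBl//.
  by rewrite (L2_innerC psi); ring.
apply: (@cvgn_eq _ _ (0 + (2 * L2_inner psi psi - L2_inner psi psi)));
  last by ring.
apply: (@cvgD _ R^o) => //.
by apply: (@cvgB _ R^o); [exact: cvgMl_tmp|exact: cvg_cst].
Qed.

End L2.

(** * Eigenfunctions and powers of the operator *)

Section Spectral.
Context {R : realType} {G : metric_graph R}.
Local Notation mu := (@lebesgue_measure R).
Implicit Types (e : edge G) (phi : graph_point G -> R) (kappa lambda : R).

Lemma edge_point0 e : edge_point e 0 = Vertex (edge_tail e).
Proof. by rewrite /edge_point insubF ?ltxx// lexx. Qed.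

Lemma edge_point_len e : edge_point e (len e) = Vertex (edge_head e).
Proof.
by rewrite /edge_point insubF ?ltxx ?andbF// leNgt len_gt0.
Qed.

Lemma mem0_itv_len e : 0 \in `[0, len e].
Proof. by rewrite in_itv/= lexx ltW// len_gt0. Qed.

Lemma mem_len_itv_len e : len e \in `[0, len e].
Proof. by rewrite in_itv/= lexx ltW// len_gt0. Qed.

Lemma deriv_tail_is_derive phi e F (m : R) :
  {in `[0, len e], restr phi e =1 F} -> is_derive (0 : R) 1 F m ->
  deriv_tail phi e = m.
Proof.
move=> phiF dF; apply/cvg_lim => //.
have [dF1 <-] := dF.
have : (fun h => h^-1 *: (F (h *: 1 + 0) - F 0)) @ 0^' --> 'D_1 F 0 by exact: dF1.
move/cvg_dnbhs_at_right; apply: cvg_trans; apply: near_eq_cvg.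
near=> h; rewrite /GRing.scale/= mulr1 addr0 mulrC !phiF ?mem0_itv_len//.
by rewrite in_itv/=; apply/andP; split; near: h;
  [exact: nbhs_right_ge|apply: nbhs_right_le; exact: len_gt0].
Unshelve. all: by end_near. Qed.

Lemma deriv_head_is_derive phi e F (m : R) :
  {in `[0, len e], restr phi e =1 F} -> is_derive (len e) 1 F m ->
  deriv_head phi e = - m.
Proof.
move=> phiF dF; apply/cvg_lim => //.
have dFr : is_derive (0 : R) 1 (fun h => F (len e - h)) (- m).
  have dF0 : is_derive (len e - 0) 1 F m by rewrite subr0.
  have dl : is_derive (0 : R) 1 (fun h => len e - h) (0 - 1) by exact: is_deriveB.
  have -> : - m = m * (0 - 1) by ring.
  exact: (@is_derive1_comp _ F (fun h => len e - h)).
have [dF1 <-] := dFr.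
set H := fun h => F (len e - h).
have : (fun h => h^-1 *: (H (h *: 1 + 0) - H 0)) @ 0^' --> 'D_1 H 0 by exact: dF1.
move/cvg_dnbhs_at_right; apply: cvg_trans; apply: near_eq_cvg.
near=> h; rewrite /GRing.scale/= mulr1 addr0 mulrC /H subr0.
rewrite !phiF ?mem_len_itv_len//.
have h0 : 0 <= h by near: h; exact: nbhs_right_ge.
have hl : h <= len e by near: h; apply: nbhs_right_le; exact: len_gt0.
by rewrite in_itv/=; apply/andP; split; lra.
Unshelve. all: by end_near. Qed.

(** Grouping the edge ends by their vertex x leaves b(x) times the Kirchhoff sum at x; a loop enters
    through both of its ends. *)
Lemma kirchhoff_boundary phi (b : vertex G -> R) : kirchhoff phi ->
  \sum_e (b (edge_tail e) * deriv_tail phi e + b (edge_head e) * deriv_head phi e)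
  = 0.
Proof.
move=> K; rewrite big_split/=.
rewrite (partition_big (@edge_tail _ G) xpredT)//=.
rewrite [X in _ + X](partition_big (@edge_head _ G) xpredT)//=.
rewrite -big_split big1//= => x _.
rewrite (eq_bigr (fun e => b x * deriv_tail phi e)); last by move=> e /eqP ->.
rewrite [X in _ + X](eq_bigr (fun e => b x * deriv_head phi e)); last first.
  by move=> e /eqP ->.
by rewrite -!mulr_sumr -mulrDr K mulr0.
Qed.

(** A C^2 extension of phi from the edge to the line makes two-sided derivatives available at the
    ends; the eigenvalue equation is asked on the edge only. *)
Definition edge_regular kappa lambda phi e (F F1 : R -> R) :=
  [/\ {in `[0, len e], restr phi e =1 F}, forall t : R, is_derive t 1 F (F1 t),
      exists2 F2, continuous F2 &
        (forall t : R, is_derive t 1 F1 (F2 t)) /\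
        {in `[0, len e], forall t, F2 t = (kappa ^+ 2 - lambda) * F t} &
      deriv_tail phi e = F1 0 /\ deriv_head phi e = - F1 (len e)].

(** The weak second derivative of an eigenfunction is a multiple of the function itself, hence
    continuous, so the du Bois-Reymond lemma makes it a classical derivative up to the ends. *)
Lemma eigenfunction_regular kappa lambda phi :
  whittle_operator kappa phi (fun e t => lambda * restr phi e t) ->
  exists F F1, forall e, edge_regular kappa lambda phi e (F e) (F1 e).
Proof.
move=> [cphi H2 K].
suff H e : exists F, exists F1, edge_regular kappa lambda phi e F F1.
  have [F {}H] := choice H; have [F1 {}H] := choice H.
  by exists F, F1.
have l0 := len_gt0 e.
pose g t := (kappa ^+ 2 - lambda) * restr phi e (clamp (len e) t).
have cg : continuous g.
  have ? := continuous_clamp (ltW l0) (cphi e).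
  have ? : continuous (fun t => restr phi e (clamp (len e) t)) by [].
  by rewrite /g; cont.
have [|F [F1 [phiF dF dF1]]] := weak_second_derivative_regular l0 (cphi e) cg.
  have [f1 [L0 L1 L2 w1 w2]] := H2 e.
  have eg : {in `[0, len e], (fun t => kappa ^+ 2 * restr phi e t -
      lambda * restr phi e t) =1 g}.
    by move=> t tl; rewrite /g clamp_id// mulrBl.
  exists f1; split=> //; first exact: eq_L2_itv L2.
  move=> p tp; rewrite w2//; congr (- _); apply: eq_int => t tl.
  by rewrite eg.
exists F, F1; split=> //.
  by exists g => //; split=> // t tl; rewrite /g clamp_id// phiF.
split; first exact: deriv_tail_is_derive (dF 0).
exact: deriv_head_is_derive (dF (len e)).
Qed.

Lemma L2_restr_eigenfunction kappa lambda phi :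
  whittle_operator kappa phi (fun e t => lambda * restr phi e t) ->
  L2_graph (restr phi).
Proof. by move=> [_ H2 _] e; have [f1 []] := H2 e. Qed.

(** Integrating phi phi'' by parts gives kappa^2 - lambda = - |phi'|^2, the boundary terms
    cancelling by the Kirchhoff condition. Positivity of the eigenvalues makes their powers multiply
    as expected. *)
Lemma eigenvalue_ge kappa lambda phi :
  whittle_operator kappa phi (fun e t => lambda * restr phi e t) ->
  L2_inner (restr phi) (restr phi) = 1 -> kappa ^+ 2 <= lambda.
Proof.
move=> E n1; have [F [F1 H]] := eigenfunction_regular E.
have [_ _ K] := E.
suff : kappa ^+ 2 - lambda <= 0 by rewrite subr_le0.
have B := kirchhoff_boundary (phi \o @Vertex _ G) K.
rewrite -[leLHS]mulr1 -n1 -[leRHS]oppr0 -[X in _ <= - X]B -sumrN.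
rewrite mulr_sumr -subr_ge0 -sumrB; apply: sumr_ge0 => e _.
have [phiF dF [F2 cF2 [dF1 F2E]] [-> ->]] := H e.
have l0 := len_gt0 e.
have cF := is_derive_continuous dF; have cF1 := is_derive_continuous dF1.
have := Rintegral_by_parts l0 cF1 cF2 dF dF1.
rewrite (@eq_int _ _
  (fun t => (kappa ^+ 2 - lambda) * (restr phi e t * restr phi e t))); last first.
  by move=> t tl; rewrite F2E// phiF//; ring.
rewrite RintegralZl//; last first.
  by apply: L2_itv_integrable_mul; exact: (L2_restr_eigenfunction E).
move=> ->; rewrite /= -edge_point0 -edge_point_len -!/(restr _ _ _).
rewrite !phiF ?mem0_itv_len ?mem_len_itv_len//.
have : 0 <= \int[mu]_(t in `[0, len e]) (F1 e t * F1 e t).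
  by apply: Rintegral_ge0 => t _; rewrite -expr2 sqr_ge0.
by lra.
Qed.

(* Green's formula: the boundary terms vanish because g takes a common value at
   each vertex and has zero normal derivatives. *)
Lemma eigenfunction_Green kappa lambda phi (b : vertex G -> R)
    (g g1 g2 : edge G -> R -> R) :
  whittle_operator kappa phi (fun e t => lambda * restr phi e t) ->
  (forall e (t : R), is_derive t 1 (g e) (g1 e t)) ->
  (forall e (t : R), is_derive t 1 (g1 e) (g2 e t)) ->
  (forall e, continuous (g2 e)) ->
  (forall e, g e 0 = b (edge_tail e) /\ g e (len e) = b (edge_head e)) ->
  (forall e, g1 e 0 = 0 /\ g1 e (len e) = 0) ->
  L2_inner (fun e t => kappa ^+ 2 * g e t - g2 e t) (restr phi) =
  lambda * L2_inner g (restr phi).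
Proof.
move=> E dg dg1 cg2 gb g10; have [F [F1 H]] := eigenfunction_regular E.
have [_ _ K] := E.
rewrite -[RHS]subr0 -[in RHS](kirchhoff_boundary b K) mulr_sumr -sumrB.
apply: eq_bigr => e _.
have [phiF dF [F2 cF2 [dF1 F2E]] [-> ->]] := H e.
have l0 := len_gt0 e.
have cF := is_derive_continuous dF; have cF1 := is_derive_continuous dF1.
have cg := is_derive_continuous (dg e); have cg1 := is_derive_continuous (dg1 e).
(* The boundary terms of [P1] vanish with [g1]; those of [P2] are the vertex terms subtracted on the
   right-hand side above. *)
have P1 := Rintegral_by_parts l0 cF1 (cg2 e) dF (dg1 e).
have P2 := Rintegral_by_parts l0 (cg1) cF2 (dg e) dF1.
have cg2e := cg2 e; have [g0 gl] := gb e; have [g10e g1le] := g10 e.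
rewrite g10e g1le !mulr0 subrr sub0r in P1.
rewrite g0 gl in P2.
rewrite (@eq_int _ _ (fun t => kappa ^+ 2 * (g e t * F e t) - F e t * g2 e t)); last first.
  by move=> t tl; rewrite phiF//; ring.
rewrite intB; [|by cont..].
rewrite intZ; last by cont.
rewrite [in RHS](@eq_int _ _ (fun t => g e t * F e t)); last first.
  by move=> t tl; rewrite phiF.
rewrite (@eq_int _ (fun t => g e t * F2 t)
  (fun t => (kappa ^+ 2 - lambda) * (g e t * F e t))) in P2; last first.
  by move=> t tl; rewrite F2E//; ring.
rewrite intZ in P2; last by cont.
rewrite P1.
rewrite (@eq_int _ (fun t => g1 e t * F1 e t)
  (fun t => F1 e t * g1 e t)) in P2; last first.
  by move=> t _; exact: mulrC.
move: P2; lra.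
Qed.

(** For psi = L g, known only through its coefficients: lambda^(-1) (psi, phi)^2 = (g, phi) (psi,
    phi) for each eigenfunction, so the partial sums for |T psi|^2 and for (g, psi) coincide term by
    term. *)
Lemma whittle_power_norm kappa (T : (edge G -> R -> R) -> edge G -> R -> R)
    (g psi : edge G -> R -> R) :
  0 < kappa -> whittle_power kappa (- (1 / 2)) T ->
  L2_graph g -> L2_graph psi ->
  (forall lambda phi,
    whittle_operator kappa phi (fun e t => lambda * restr phi e t) ->
    L2_inner psi (restr phi) = lambda * L2_inner g (restr phi)) ->
  L2_inner (T psi) (T psi) = L2_inner g psi.
Proof.
move=> k0 [lambda [phi [[eig ortho complete] HT]]] Lg Lpsi sym.
have [LT cvT] := HT psi Lpsi.
have Lphi k : L2_graph (restr (phi k)) := L2_restr_eigenfunction (eig k).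
have l0 k : 0 < lambda k.
  apply: lt_le_trans (eigenvalue_ge (eig k) _); first by rewrite exprn_gt0.
  by rewrite ortho eqxx.
pose S n e t := \sum_(k < n) (lambda k `^ (- (1 / 2))) *
        L2_inner psi (restr (phi k)) * restr (phi k) e t.
have LS n : L2_graph (S n).
  exact: (@L2_graph_sum _ _ n
    (fun k => lambda k `^ (- (1 / 2)) * L2_inner psi (restr (phi k)))
    (fun k => restr (phi k)) Lphi).
have cS := L2_cvg_norm LS LT cvT.
pose S' n e t := \sum_(k < n) L2_inner g (restr (phi k)) * restr (phi k) e t.
have LS' n : L2_graph (S' n).
  exact: (@L2_graph_sum _ _ n (fun k => L2_inner g (restr (phi k)))
    (fun k => restr (phi k)) Lphi).
have cS' := L2_cvg_inner LS' Lg Lpsi (complete g Lg).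
suff SE n : L2_inner (S n) (S n) = L2_inner (S' n) psi.
  have SE' : (fun n => L2_inner (S n) (S n)) = (fun n => L2_inner (S' n) psi).
    exact/funext.
  by rewrite SE' in cS; exact: (cvg_unique _ cS cS').
pose c k := lambda k `^ (- (1 / 2)) * L2_inner psi (restr (phi k)).
have suml a chi (Lchi : L2_graph chi) :=
  @L2_inner_suml _ _ n a (fun k => restr (phi k)) chi Lphi Lchi.
rewrite (suml c)// (suml (fun k => L2_inner g (restr (phi k))))//.
apply: eq_bigr => k _.
rewrite L2_innerC (suml c)// {}/c.
rewrite (bigD1 k)//= ortho eqxx mulr1 big1 ?addr0; last first.
  move=> j jk; rewrite ortho; have /negbTE -> : nat_of_ord j != k by [].
  by rewrite mulr0.
rewrite mulrACA -powRD; last by apply/implyP => _; rewrite gt_eqF.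
rewrite (_ : - (1 / 2) + - (1 / 2) = -1); last by field.
rewrite powR_inv1 ?ltW// (L2_innerC (restr _)) (sym _ _ (eig k)).
by field; rewrite gt_eqF.
Qed.

End Spectral.

(** * Approximate identities at the ends of an interval *)

Ltac nat_neq0 := by repeat (apply/andP; split);
  first [assumption | rewrite gt_eqF// ?ltr_pwDl].

Section EdgeApproximation.
Context {R : realType}.
Local Notation mu := (@lebesgue_measure R).
Implicit Types (l t c : R) (h : bool) (n : nat).

(* One minus the normalized distance to the end of [0, l] selected by h: the
   tail 0 for [false], the head l for [true]. *)
Definition closeness h l t : R := if h then t / l else 1 - t / l.

Definition slope h l : R := if h then l^-1 else - l^-1.

(** In the variable [closeness], [kernel1] and [kernel2] are, up to the factor 1 / l, the densities
    of the Beta(n + 1, 1) and Beta(n + 1, 2) laws, which concentrate at the selected end. *)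
Definition kernel1 h l n t : R := n.+1%:R / l * closeness h l t ^+ n.

Definition kernel2 h l n t : R :=
  n.+1%:R * n.+2%:R / l * ((1 - closeness h l t) * closeness h l t ^+ n).

(* Vanishes at both ends, as does its derivative at the opposite end; its
   derivative into [0, l] at the selected end is -1, and its second derivative
   [corrector2] is a difference of approximate identities, of masses 2 and 1,
   at the selected end. *)
Definition corrector h l n t : R :=
  - l * ((1 - closeness h l t) * closeness h l t ^+ n.+2).

Definition corrector1 h l n t : R :=
  - l * slope h l *
    (n.+2%:R * closeness h l t ^+ n.+1 - n.+3%:R * closeness h l t ^+ n.+2).

Definition corrector2 h l n t : R := 2 * kernel1 h l n.+1 t - kernel2 h l n t.

Lemma is_derive_closeness h l t : is_derive t 1 (closeness h l) (slope h l).
Proof.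
have d : is_derive t 1 (fun t => l^-1 * t) (l^-1 * 1).
  exact: (@is_deriveZ _ _ _ id l^-1 t 1 1).
rewrite /closeness /slope; case: h.
  have -> : (fun t => t / l) = (fun t => l^-1 * t) by apply/funext => y; rewrite mulrC.
  by rewrite mulr1 in d.
have -> : (fun t => 1 - t / l) = (fun t => 1 - l^-1 * t).
  by apply/funext => y; rewrite [y / l]mulrC.
have -> : - l^-1 = 0 - l^-1 * 1 by rewrite mulr1 sub0r.
exact: is_deriveB.
Qed.

Lemma is_derive_closenessX h l n t :
  is_derive t 1 (fun t => closeness h l t ^+ n.+1)
    (n.+1%:R * closeness h l t ^+ n * slope h l).
Proof.
have d := is_derive_closeness h l t.
have := @is_deriveX _ _ (closeness h l) n.+1 t 1 _ d.
by rewrite exprfctE.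
Qed.

Lemma continuous_closeness h l : continuous (closeness h l).
Proof. exact: is_derive_continuous (is_derive_closeness h l). Qed.

Lemma closeness_itv h l t : 0 < l -> t \in `[0, l] -> 0 <= closeness h l t <= 1.
Proof.
move=> l0; rewrite in_itv/= => /andP[t0 tl].
have tl0 : 0 <= t / l by rewrite divr_ge0// ltW.
have tl1 : t / l <= 1 by rewrite ler_pdivrMr// mul1r.
by rewrite /closeness; case: h; apply/andP; split; lra.
Qed.

Lemma closeness_end0 h l : closeness h l 0 = (~~ h)%:R.
Proof. by rewrite /closeness mul0r subr0; case: h. Qed.

Lemma closeness_endl h l : 0 < l -> closeness h l l = h%:R.
Proof.
by move=> l0; rewrite /closeness divff ?gt_eqF//; case: h; rewrite ?subrr.
Qed.

Lemma int_closenessX h l n : 0 < l ->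
  \int[mu]_(t in `[0, l]) (closeness h l t ^+ n) = l / n.+1%:R.
Proof.
move=> l0; have cs := @continuous_closeness h l.
have cX : continuous (fun t => closeness h l t ^+ n) by cont.
have sl : slope h l != 0 by rewrite /slope; case: (h); rewrite ?oppr_eq0 invr_eq0 gt_eqF.
have dF t : is_derive t 1
    (fun t => (n.+1%:R * slope h l)^-1 * closeness h l t ^+ n.+1)
    (closeness h l t ^+ n).
  have d := is_derive_closenessX h l n t.
  have d' := @is_deriveZ _ _ _ (fun t => closeness h l t ^+ n.+1)
    (n.+1%:R * slope h l)^-1 t 1 _ d.
  refine (is_derive_eq d' _); rewrite /GRing.scale/=.
  by field; nat_neq0.
rewrite (Rintegral_is_derive l0 cX dF) closeness_end0 closeness_endl// /slope.
have l1 : l != 0 by rewrite gt_eqF.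
by case: h {cs cX sl dF} => /=; rewrite ?expr1n ?expr0n/=; field; nat_neq0.
Qed.

Lemma continuous_kernel1 h l n : continuous (kernel1 h l n).
Proof. by have ? := @continuous_closeness h l; rewrite /kernel1; cont. Qed.

Lemma continuous_kernel2 h l n : continuous (kernel2 h l n).
Proof. by have ? := @continuous_closeness h l; rewrite /kernel2; cont. Qed.

Lemma int_kernel1 h l n : 0 < l -> \int[mu]_(t in `[0, l]) kernel1 h l n t = 1.
Proof.
move=> l0; have ? := @continuous_closeness h l.
rewrite /kernel1 intZ; last by cont.
by rewrite int_closenessX//; field; nat_neq0.
Qed.

Lemma int_kernel1_dist h l n : 0 < l ->
  \int[mu]_(t in `[0, l]) ((1 - closeness h l t) * kernel1 h l n t) = n.+2%:R^-1.
Proof.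
move=> l0; have ? := @continuous_closeness h l.
rewrite (@eq_int _ _ (fun t =>
  n.+1%:R / l * (closeness h l t ^+ n - closeness h l t ^+ n.+1))).
  rewrite intZ ?intB; [|by cont..].
  by rewrite !int_closenessX//; field; nat_neq0.
by move=> t _; rewrite /kernel1 exprS; ring.
Qed.

Lemma int_kernel2 h l n : 0 < l -> \int[mu]_(t in `[0, l]) kernel2 h l n t = 1.
Proof.
move=> l0; have ? := @continuous_closeness h l.
rewrite (@eq_int _ _ (fun t => n.+1%:R * n.+2%:R / l *
  (closeness h l t ^+ n - closeness h l t ^+ n.+1))).
  rewrite intZ ?intB; [|by cont..].
  by rewrite !int_closenessX//; field; nat_neq0.
by move=> t _; rewrite /kernel2 exprS; ring.
Qed.

Lemma int_kernel2_dist h l n : 0 < l ->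
  \int[mu]_(t in `[0, l]) ((1 - closeness h l t) * kernel2 h l n t) = 2 / n.+3%:R.
Proof.
move=> l0; have ? := @continuous_closeness h l.
rewrite (@eq_int _ _ (fun t => n.+1%:R * n.+2%:R / l *
  (closeness h l t ^+ n - 2 * closeness h l t ^+ n.+1 + closeness h l t ^+ n.+2))).
  rewrite intZ; last by cont.
  rewrite intD; [|by cont..].
  rewrite intB; [|by cont..].
  rewrite intZ; last by cont.
  by rewrite !int_closenessX//; field; nat_neq0.
by move=> t _; rewrite /kernel2 !exprS; ring.
Qed.

Lemma kernel1_ge0 h l n t : 0 < l -> t \in `[0, l] -> 0 <= kernel1 h l n t.
Proof.
move=> l0 /(closeness_itv h l0)/andP[s0 s1].
by rewrite /kernel1 mulr_ge0 ?exprn_ge0// divr_ge0// ltW.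
Qed.

Lemma kernel2_ge0 h l n t : 0 < l -> t \in `[0, l] -> 0 <= kernel2 h l n t.
Proof.
move=> l0 /(closeness_itv h l0)/andP[s0 s1]; rewrite /kernel2.
rewrite mulr_ge0//; first by rewrite divr_ge0 ?mulr_ge0 ?ltW.
by rewrite mulr_ge0 ?subr_ge0 ?exprn_ge0.
Qed.

Lemma is_derive_corrector h l n t :
  is_derive t 1 (corrector h l n) (corrector1 h l n t).
Proof.
have d1 := is_derive_closenessX h l n.+1 t; have d2 := is_derive_closenessX h l n.+2 t.
have -> : corrector h l n =
    (fun t => - l * (closeness h l t ^+ n.+2 - closeness h l t ^+ n.+3)).
  apply/funext => y; rewrite /corrector; move: (closeness h l y) => s.
  by rewrite (exprS s n.+2); ring.
have d := @is_deriveB _ _ _ _ _ t 1 _ _ d1 d2.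
have d' := @is_deriveZ _ _ _ _ (- l) t 1 _ d.
by refine (is_derive_eq d' _); rewrite /GRing.scale/= /corrector1; ring.
Qed.

Lemma is_derive_corrector1 h l n t : 0 < l ->
  is_derive t 1 (corrector1 h l n) (corrector2 h l n t).
Proof.
move=> l0.
have d1 := @is_deriveZ _ _ _ _ (n.+2%:R : R) t 1 _ (is_derive_closenessX h l n t).
have d2 := @is_deriveZ _ _ _ _ (n.+3%:R : R) t 1 _ (is_derive_closenessX h l n.+1 t).
have d := @is_deriveB _ _ _ _ _ t 1 _ _ d1 d2.
have d' := @is_deriveZ _ _ _ _ (- l * slope h l) t 1 _ d.
refine (is_derive_eq d' _); rewrite /GRing.scale/= /corrector2 /kernel1 /kernel2.
have l1 : l != 0 by rewrite gt_eqF.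
by rewrite exprS /slope; case: h {d1 d2 d d'}; field.
Qed.

Lemma continuous_corrector2 h l n : continuous (corrector2 h l n).
Proof.
have ? := @continuous_kernel1 h l n.+1; have ? := @continuous_kernel2 h l n.
by rewrite /corrector2; cont.
Qed.

(** The corrector is thus a factor of order n^(-2) times an approximate identity, and only its
    second derivative survives in the limit. *)
Lemma correctorE h l n t : 0 < l ->
  corrector h l n t = - (l ^+ 2 / (n.+3%:R * n.+4%:R)) * kernel2 h l n.+2 t.
Proof.
by move=> l0; rewrite /corrector /kernel2; field; nat_neq0.
Qed.

Lemma corrector_end0 h l n : corrector h l n 0 = 0.
Proof.
by rewrite /corrector closeness_end0; case: h;
  rewrite /= ?expr0n ?subrr/= ?mul0r ?mulr0 ?mulr0.
Qed.

Lemma corrector_endl h l n : 0 < l -> corrector h l n l = 0.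
Proof.
by move=> l0; rewrite /corrector closeness_endl//; case: h;
  rewrite /= ?expr0n ?subrr/= ?mul0r ?mulr0 ?mulr0.
Qed.

Lemma corrector1_end0 h l n : 0 < l -> corrector1 h l n 0 = - (~~ h)%:R.
Proof.
move=> l0; rewrite /corrector1 closeness_end0 /slope; case: h => /=.
  by rewrite !expr0n/= !mulr0 subr0 mulr0 oppr0.
by rewrite !expr1n; field; rewrite gt_eqF.
Qed.

Lemma corrector1_endl h l n : 0 < l -> corrector1 h l n l = h%:R.
Proof.
move=> l0; rewrite /corrector1 closeness_endl// /slope; case: h => /=.
  by rewrite !expr1n; field; rewrite gt_eqF.
by rewrite !expr0n/= !mulr0 subr0 mulr0.
Qed.

(** The bound must hold at both ends, uniformly in n. At the end opposite to [h'], the distance 1 -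
    [closeness h] is [closeness h'], a power of which is a factor of the corrector. *)
Lemma norm_corrector_le h h' l n t : 0 < l -> t \in `[0, l] ->
  `|corrector h' l n t| <= l * (1 - closeness h l t).
Proof.
move=> l0 tl; have /andP[s0 s1] := closeness_itv h l0 tl.
have /andP[s0' s1'] := closeness_itv h' l0 tl.
rewrite /corrector normrM normrN (gtr0_norm l0); apply: ler_wpM2l; first exact: ltW.
rewrite ger0_norm; last by rewrite mulr_ge0 ?subr_ge0 ?exprn_ge0.
have [<-|hh'] := eqVneq h h'.
  by rewrite ler_piMr ?subr_ge0// exprn_ile1.
have -> : 1 - closeness h l t = closeness h' l t.
  by move: hh'; rewrite /closeness; case: h {s0 s1}; case: h' {s0' s1'} => //= _; ring.
rewrite exprS mulrCA ler_piMr// mulr_ile1 ?subr_ge0 ?exprn_ge0 ?exprn_ile1//.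
by rewrite gerBl.
Qed.

(* Uniform modulus of continuity, at the end selected by h, of a sequence of
   functions. *)
Definition equicontinuous_end h l (r : nat -> R -> R) c := forall eps : R, 0 < eps ->
  exists2 M, 0 <= M & forall n t, t \in `[0, l] ->
    `|r n t - c| <= eps + M * (1 - closeness h l t).

(** The kernels have mass 1, so the error is at most eps / 2 plus M times the mean distance to the
    end, which is of order 1 / n. *)
Lemma cvg_int_kernel h l (r k : nat -> R -> R) c : 0 < l ->
  (forall n, continuous (r n)) -> (forall n, continuous (k n)) ->
  (forall n t, t \in `[0, l] -> 0 <= k n t) ->
  (forall n, \int[mu]_(t in `[0, l]) k n t = 1) ->
  (forall n, \int[mu]_(t in `[0, l]) ((1 - closeness h l t) * k n t) <= 2 * n.+1%:R^-1) ->
  equicontinuous_end h l r c ->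
  (fun n => \int[mu]_(t in `[0, l]) (r n t * k n t)) @ \oo --> c.
Proof.
move=> l0 cr ck k0 k1 kd er; have cs := @continuous_closeness h l.
apply/cvgrPdist_le => eps eps0.
have [M M0 rM] := er (eps / 2) (divr_gt0 eps0 (ltr0Sn _ _)).
have hM : (fun n : nat => M * 2 * n.+1%:R^-1) @ \oo --> (0 : R).
  apply: (@cvgn_eq _ _ (M * 2 * 0)); last by rewrite mulr0.
  by apply: cvgMl_tmp; exact: cvg_harmonic.
have /cvgrPdist_le/(_ (eps / 2) (divr_gt0 eps0 (ltr0Sn _ _))) := hM.
apply: filterS => n; rewrite sub0r normrN ger0_norm ?mulr_ge0 ?invr_ge0// => Mn.
have crn := cr n; have ckn := ck n.
rewrite distrC -[X in _ - X]mulr1 -(k1 n) -intZ//.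
rewrite -intB; [|by cont..].
rewrite (@eq_int _ _ (fun t => (r n t - c) * k n t)); last first.
  by move=> t _; rewrite mulrBl.
apply: (le_trans (le_normr_Rintegral _ _)) => //.
  by apply: continuous_integrable; cont.
apply: (@le_trans _ _ (\int[mu]_(t in `[0, l])
   (eps / 2 * k n t + M * ((1 - closeness h l t) * k n t)))).
  apply: le_Rintegral => //.
  - apply: (@integrable_norm _ _ _ mu `[0, l]%classic (fun t => (r n t - c) * k n t)).
    by apply: continuous_integrable; cont.
  - by apply: continuous_integrable; cont.
  - move=> t tl; rewrite normrM (ger0_norm (k0 n t tl)) mulrA -mulrDl.
    by apply: ler_wpM2r; [exact: k0|exact: rM].
rewrite intD; [|by cont..].
rewrite !intZ; [|by cont..].
rewrite k1 mulr1; apply: (@le_trans _ _ (eps / 2 + M * (2 * n.+1%:R^-1))).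
  by rewrite lerD2l ler_wpM2l.
by move: Mn; move: (n.+1%:R^-1) => a; lra.
Qed.

(** Minus [corrector2] has masses 1 and -2 near the end, giving c - 2 c, and the term with kappa^2
    tends to 0. *)
Lemma cvg_int_corrector (kappa : R) h l (r : nat -> R -> R) c : 0 < l ->
  (forall n, continuous (r n)) -> equicontinuous_end h l r c ->
  (fun n => \int[mu]_(t in `[0, l])
    (r n t * (kappa ^+ 2 * corrector h l n t - corrector2 h l n t))) @ \oo --> - c.
Proof.
move=> l0 cr er.
have invle (a b : nat) : (a < b)%N -> b.+1%:R^-1 <= a.+1%:R^-1 :> R.
  by move=> ab; rewrite lef_pV2 ?posrE// ler_nat ltnW.
have c1 := @cvg_int_kernel h l r (fun n => kernel1 h l n.+1) c l0 cr
  (fun n => @continuous_kernel1 h l n.+1) (fun n t => @kernel1_ge0 h l n.+1 t l0)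
  (fun n => int_kernel1 h n.+1 l0).
have c2 := @cvg_int_kernel h l r (kernel2 h l) c l0 cr
  (@continuous_kernel2 h l) (fun n t => @kernel2_ge0 h l n t l0)
  (fun n => int_kernel2 h n l0).
have c3 := @cvg_int_kernel h l r (fun n => kernel2 h l n.+2) c l0 cr
  (fun n => @continuous_kernel2 h l n.+2) (fun n t => @kernel2_ge0 h l n.+2 t l0)
  (fun n => int_kernel2 h n.+2 l0).
have {}c1 : (fun n => \int[mu]_(t in `[0, l]) (r n t * kernel1 h l n.+1 t)) @ \oo --> c.
  apply: c1 => // n; rewrite int_kernel1_dist//.
  have := invle n n.+2 (ltnW (ltnSn _)); have : 0 <= n.+1%:R^-1 :> R by rewrite invr_ge0.
  by move: (n.+1%:R^-1) (n.+3%:R^-1) => a b; lra.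
have {}c2 : (fun n => \int[mu]_(t in `[0, l]) (r n t * kernel2 h l n t)) @ \oo --> c.
  by apply: c2 => // n; rewrite int_kernel2_dist// ler_pM2l// invle.
have {}c3 : (fun n => \int[mu]_(t in `[0, l]) (r n t * kernel2 h l n.+2 t)) @ \oo --> c.
  apply: c3 => // n; rewrite int_kernel2_dist// ler_pM2l//; apply: invle.
  by rewrite -[n.+4]addn4 -addn1 leq_add2l.
have cn : (fun n : nat => kappa ^+ 2 * l ^+ 2 * (n.+3%:R * n.+4%:R)^-1) @ \oo --> (0 : R).
  apply: (@cvgn_eq _ _ (kappa ^+ 2 * l ^+ 2 * 0)); last by rewrite mulr0.
  apply: cvgMl_tmp.
  apply: (@squeeze_cvgr _ _ _ _ (cst 0) (fun n : nat => n.+1%:R^-1)).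
  - near=> n; rewrite invr_ge0 mulr_ge0//= -natrM lef_pV2 ?posrE ?ltr0n ?muln_gt0//.
    by rewrite ler_nat mulnS (leq_trans _ (leq_addr _ _))// -addn2 leq_addr.
  - exact: cvg_cst.
  - exact: cvg_harmonic.
have E n : \int[mu]_(t in `[0, l])
    (r n t * (kappa ^+ 2 * corrector h l n t - corrector2 h l n t)) =
  - (kappa ^+ 2 * l ^+ 2 * (n.+3%:R * n.+4%:R)^-1 *
     \int[mu]_(t in `[0, l]) (r n t * kernel2 h l n.+2 t)) +
  (\int[mu]_(t in `[0, l]) (r n t * kernel2 h l n t) -
   2 * \int[mu]_(t in `[0, l]) (r n t * kernel1 h l n.+1 t)).
  have crn := cr n; have ? := @continuous_kernel2 h l n.
  have ? := @continuous_kernel2 h l n.+2; have ? := @continuous_kernel1 h l n.+1.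
  rewrite -mulNr -!intZ; [|by cont..].
  rewrite -intB; [|by cont..].
  rewrite -intD; [|by cont..].
  by apply: eq_int => t _; rewrite correctorE// /corrector2; field; nat_neq0.
rewrite (funext E).
apply: (@cvgn_eq _ _ (- (0 * c) + (c - 2 * c))); last by ring.
apply: (@cvgD _ R^o).
  by apply: (@cvgN _ R^o); exact: cvgM.
by apply: (@cvgB _ R^o) => //; exact: cvgMl_tmp.
Unshelve. all: by end_near. Qed.

End EdgeApproximation.

(** * Interpolation on an edge *)

Section EdgeLimit.
Context {R : realType}.
Local Notation mu := (@lebesgue_measure R).
Implicit Types (l t c kappa x y : R) (h : bool) (n : nat).

Definition end_point h l : R := if h then l else 0.

Lemma dist_end_point h l t : 0 < l -> t \in `[0, l] ->
  `|t - end_point h l| = l * (1 - closeness h l t).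
Proof.
move=> l0; rewrite in_itv/= => /andP[t0 tl]; rewrite /end_point /closeness.
have l1 : l != 0 by rewrite gt_eqF.
case: h; first by rewrite distrC ger0_norm ?subr_ge0//; field.
by rewrite subr0 ger0_norm//; field.
Qed.

Lemma end_point_itv h l : 0 < l -> end_point h l \in `[0, l].
Proof. by move=> l0; rewrite in_itv/= /end_point; case: h; rewrite lexx ltW. Qed.

(** Within delta of the end a, continuity bounds the deviation by eps; farther away the maximum B of
    |r - r(a)| is at most B |t - a| / delta, which fixes the constant B l / delta. *)
Lemma equicontinuous_end_cst h l (r : R -> R) : 0 < l -> continuous r ->
  equicontinuous_end h l (fun=> r) (r (end_point h l)).
Proof.
move=> l0 cr eps eps0.
have a_in := end_point_itv h l0; set a := end_point h l in a_in *.
have : \forall t \near a, `|r a - r t| <= eps.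
  by have /cvgrPdist_le/(_ eps eps0) := cr a.
move=> /nbhs_ballP[delta /= delta0 near_a].
have cd : {within `[0, l], continuous (fun t => `|r t - r a|)}.
  apply: continuous_subspaceT => t; apply: cvg_norm.
  by apply: (@cvgB _ R^o); [exact: cr|exact: cvg_cst].
have [m _ rm] := EVT_max (ltW l0) cd.
set B := `|r m - r a| in rm.
have B0 : 0 <= B by exact: normr_ge0.
have M0 : 0 <= B * l / delta by rewrite divr_ge0 ?mulr_ge0 ?(ltW l0) ?(ltW delta0).
exists (B * l / delta) => // _ t tl; have [td|td] := ltP `|t - a| delta.
  apply: (@le_trans _ _ eps).
    by rewrite distrC; apply: near_a; rewrite /ball/= distrC.
  have /andP[_ s1] := closeness_itv h l0 tl.
  by rewrite lerDl mulr_ge0// subr_ge0.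
apply: (le_trans (rm t tl)); rewrite ler_wpDl ?(ltW eps0)//.
have -> : B * l / delta * (1 - closeness h l t) = B * (`|t - a| / delta).
  by rewrite dist_end_point//; ring.
by rewrite ler_peMr// ler_pdivlMr// mul1r.
Qed.

(* The solution of f'' = kappa^2 f with f(0) = x and f(l) = y. *)
Definition hyperbolic kappa l x y t : R :=
  let z := expR (- kappa * l) in
  (z * (y - x * z)) / (1 - z ^+ 2) * expR (kappa * t)
  + (x - y * z) / (1 - z ^+ 2) * expR (- (kappa * t)).

Definition hyperbolic1 kappa l x y t : R :=
  let z := expR (- kappa * l) in
  kappa * ((z * (y - x * z)) / (1 - z ^+ 2) * expR (kappa * t)
  - (x - y * z) / (1 - z ^+ 2) * expR (- (kappa * t))).

(* Minus the derivative at 0 of [hyperbolic kappa l x y]. *)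
Definition flux kappa l x y : R :=
  let z := expR (- kappa * l) in
  kappa * ((1 + z ^+ 2) / (1 - z ^+ 2) * x - 2 * z / (1 - z ^+ 2) * y).

Lemma expRN_lt1 kappa l : 0 < kappa -> 0 < l ->
  0 < expR (- kappa * l) < 1.
Proof.
move=> k0 l0; rewrite expR_gt0/= -expR0 ltr_expR mulNr oppr_lt0.
exact: mulr_gt0.
Qed.

Lemma is_derive_expR_lin (k t : R) :
  is_derive t 1 (fun t => expR (k * t)) (k * expR (k * t)).
Proof.
have d1 : is_derive t 1 (fun t => k * t) (k * 1).
  exact: (@is_deriveZ _ _ _ id k t 1 1).
have d := @is_derive1_comp _ expR (fun t => k * t) t _ _ (is_derive_expR _) d1.
by refine (is_derive_eq d _); rewrite mulr1 mulrC.
Qed.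

Lemma is_derive_exp2 (k c1 c2 t : R) :
  is_derive t 1 (fun t => c1 * expR (k * t) + c2 * expR (- (k * t)))
    (k * (c1 * expR (k * t) - c2 * expR (- (k * t)))).
Proof.
have E : (fun t : R => c1 * expR (k * t) + c2 * expR (- (k * t))) =
    (fun t => c1 * expR (k * t) + c2 * expR (- k * t)).
  by apply/funext => s; rewrite mulNr.
rewrite E.
have d1 := @is_deriveZ _ _ _ _ c1 t 1 _ (is_derive_expR_lin k t).
have d2 := @is_deriveZ _ _ _ _ c2 t 1 _ (is_derive_expR_lin (- k) t).
have d := @is_deriveD _ _ _ _ _ t 1 _ _ d1 d2.
by refine (is_derive_eq d _); rewrite /GRing.scale/= (mulNr k t); ring.
Qed.

Lemma is_derive_hyperbolic kappa l x y t :
  is_derive t 1 (hyperbolic kappa l x y) (hyperbolic1 kappa l x y t).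
Proof. exact: is_derive_exp2. Qed.

Lemma is_derive_hyperbolic1 kappa l x y t :
  is_derive t 1 (hyperbolic1 kappa l x y) (kappa ^+ 2 * hyperbolic kappa l x y t).
Proof.
rewrite /hyperbolic1 /hyperbolic; set z := expR (- kappa * l).
set c1 := z * _ / _; set c2 := (x - _) / _.
have d := is_derive_exp2 kappa c1 (- c2) t.
have d' := @is_deriveZ _ _ _ _ kappa t 1 _ d.
have -> : (fun t0 => kappa * (c1 * expR (kappa * t0) - c2 * expR (- (kappa * t0)))) =
    kappa \*: (fun t => c1 * expR (kappa * t) + - c2 * expR (- (kappa * t))).
  by apply/funext => s; rewrite /GRing.scale/= mulNr.
by refine (is_derive_eq d' _); rewrite /GRing.scale/=; ring.
Qed.

(** Reflecting the interval exchanges x and y, so [flux kappa l y x] is minus the derivative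
    directed into the edge at l. *)
Lemma hyperbolic_ends kappa l x y : 0 < kappa -> 0 < l ->
  [/\ hyperbolic kappa l x y 0 = x, hyperbolic kappa l x y l = y,
      hyperbolic1 kappa l x y 0 = - flux kappa l x y &
      hyperbolic1 kappa l x y l = flux kappa l y x].
Proof.
move=> k0 l0; rewrite /hyperbolic /hyperbolic1 /flux !mulr0 oppr0 expR0.
have E : expR (kappa * l) = (expR (- kappa * l))^-1 by rewrite mulNr expRN invrK.
rewrite E -(mulNr kappa l).
have /andP[] := expRN_lt1 k0 l0; move: (expR _) => z z0 z1.
have zn : z != 0 by rewrite gt_eqF.
have zz : 1 - z ^+ 2 != 0 by rewrite gt_eqF// subr_gt0 expr_lt1// ltW.
by split; field; rewrite ?zn ?zz.
Qed.

(** Each corrector has derivative -1 into the edge at its own end and 0 at the other, so these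
    multiples cancel the end derivatives of [hyperbolic] and keep its end values. *)
Definition edge_approx kappa l x y n t : R :=
  hyperbolic kappa l x y t - flux kappa l x y * corrector false l n t
  - flux kappa l y x * corrector true l n t.

Definition edge_approx1 kappa l x y n t : R :=
  hyperbolic1 kappa l x y t - flux kappa l x y * corrector1 false l n t
  - flux kappa l y x * corrector1 true l n t.

Definition edge_approx2 kappa l x y n t : R :=
  kappa ^+ 2 * hyperbolic kappa l x y t - flux kappa l x y * corrector2 false l n t
  - flux kappa l y x * corrector2 true l n t.

Lemma is_derive_lin3 (f g h f' g' h' : R -> R) (a b t : R) :
  is_derive t 1 f (f' t) -> is_derive t 1 g (g' t) -> is_derive t 1 h (h' t) ->
  is_derive t 1 (fun t => f t - a * g t - b * h t) (f' t - a * g' t - b * h' t).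
Proof.
move=> df dg dh.
have d1 := @is_deriveZ _ _ _ _ a t 1 _ dg.
have d2 := @is_deriveZ _ _ _ _ b t 1 _ dh.
exact: (@is_deriveB _ _ _ _ _ t 1 _ _ (@is_deriveB _ _ _ _ _ t 1 _ _ df d1) d2).
Qed.

Lemma is_derive_edge_approx kappa l x y n t :
  is_derive t 1 (edge_approx kappa l x y n) (edge_approx1 kappa l x y n t).
Proof.
apply: is_derive_lin3; [exact: is_derive_hyperbolic|exact: is_derive_corrector..].
Qed.

Lemma is_derive_edge_approx1 kappa l x y n t : 0 < l ->
  is_derive t 1 (edge_approx1 kappa l x y n) (edge_approx2 kappa l x y n t).
Proof.
move=> l0; apply: (@is_derive_lin3 _ _ _ (fun t => kappa ^+ 2 * hyperbolic kappa l x y t)).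
- exact: is_derive_hyperbolic1.
- exact: is_derive_corrector1.
- exact: is_derive_corrector1.
Qed.

Lemma continuous_edge_approx2 kappa l x y n : 0 < l ->
  continuous (edge_approx2 kappa l x y n).
Proof.
move=> l0; have ? := is_derive_continuous (is_derive_hyperbolic kappa l x y).
have ? := @continuous_corrector2 R false l n.
have ? := @continuous_corrector2 R true l n.
by rewrite /edge_approx2; cont.
Qed.

Lemma edge_approx_ends kappa l x y n : 0 < kappa -> 0 < l ->
  [/\ edge_approx kappa l x y n 0 = x, edge_approx kappa l x y n l = y,
      edge_approx1 kappa l x y n 0 = 0 & edge_approx1 kappa l x y n l = 0].
Proof.
move=> k0 l0; rewrite /edge_approx /edge_approx1.
have [-> -> -> ->] := hyperbolic_ends x y k0 l0.
rewrite !corrector_end0 !corrector_endl// !corrector1_end0// !corrector1_endl//=.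
by split; ring.
Qed.

(** The correctors are bounded by the distance to the end uniformly in n, which only enlarges the
    constant M of [hyperbolic]. This allows [edge_approx] itself as the varying integrand in the
    limit of the variances. *)
Lemma equicontinuous_end_approx kappa h l x y : 0 < kappa -> 0 < l ->
  equicontinuous_end h l (edge_approx kappa l x y) (if h then y else x).
Proof.
move=> k0 l0 eps eps0.
have ch := is_derive_continuous (is_derive_hyperbolic kappa l x y).
have [M M0 HM] := equicontinuous_end_cst h l0 ch eps0.
have fE : hyperbolic kappa l x y (end_point h l) = if h then y else x.
  by have [f0 fl _ _] := hyperbolic_ends x y k0 l0; rewrite /end_point; case: (h).
rewrite fE in HM; set c := if h then y else x in HM *.
set a := flux kappa l x y; set b := flux kappa l y x.
exists (M + `|a| * l + `|b| * l).
  by rewrite !addr_ge0// mulr_ge0// ltW.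
move=> n t tl; have := HM n t tl.
have n1 := norm_corrector_le h false n l0 tl.
have n2 := norm_corrector_le h true n l0 tl.
rewrite /edge_approx -/a -/b => Ht.
set f := hyperbolic _ _ _ _ _ in Ht *.
have -> : f - a * corrector false l n t - b * corrector true l n t - c =
  (f - c) - a * corrector false l n t - b * corrector true l n t by ring.
apply: (le_trans (ler_normB _ _)).
apply: (le_trans (lerD (ler_normB _ _) (lexx _))).
rewrite (normrM a) (normrM b).
have : `|a| * `|corrector false l n t| <= `|a| * (l * (1 - closeness h l t)).
  exact: ler_wpM2l.
have : `|b| * `|corrector true l n t| <= `|b| * (l * (1 - closeness h l t)).
  exact: ler_wpM2l.
move: Ht; move: (`|a| * `|corrector false l n t|) (`|b| * `|corrector true l n t|).
by move: (`|a|) (`|b|) (`|f - c|) (closeness h l t) => A B C s P Q; lra.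
Qed.

(** The operator kappa^2 - d^2/dt^2 kills [hyperbolic], so only the two correctors contribute, each
    one its flux times the limit value at its end. *)
Lemma cvg_int_edge_approx kappa l x y (r : nat -> R -> R) (c0 cl : R) :
  0 < kappa -> 0 < l -> (forall n, continuous (r n)) ->
  equicontinuous_end false l r c0 -> equicontinuous_end true l r cl ->
  (fun n => \int[mu]_(t in `[0, l]) (r n t *
    (kappa ^+ 2 * edge_approx kappa l x y n t - edge_approx2 kappa l x y n t)))
  @ \oo --> flux kappa l x y * c0 + flux kappa l y x * cl.
Proof.
move=> k0 l0 cr r0 rl.
have c1 := cvg_int_corrector kappa l0 cr r0.
have c2 := cvg_int_corrector kappa l0 cr rl.
have E n : \int[mu]_(t in `[0, l]) (r n t *
    (kappa ^+ 2 * edge_approx kappa l x y n t - edge_approx2 kappa l x y n t)) =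
  - flux kappa l x y * \int[mu]_(t in `[0, l])
    (r n t * (kappa ^+ 2 * corrector false l n t - corrector2 false l n t)) +
  - flux kappa l y x * \int[mu]_(t in `[0, l])
    (r n t * (kappa ^+ 2 * corrector true l n t - corrector2 true l n t)).
  have crn := cr n.
  have ? := is_derive_continuous (is_derive_corrector false l n).
  have ? := is_derive_continuous (is_derive_corrector true l n).
  have ? := @continuous_corrector2 R false l n.
  have ? := @continuous_corrector2 R true l n.
  rewrite -!intZ; [|by cont..].
  rewrite -intD; [|by cont..].
  by apply: eq_int => t _; rewrite /edge_approx /edge_approx2; ring.
rewrite (funext E).
apply: (@cvgn_eq _ _ (- flux kappa l x y * - c0 + - flux kappa l y x * - cl)); last by ring.
by apply: (@cvgD _ R^o); exact: cvgMl_tmp.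
Qed.

End EdgeLimit.

(** * The precision matrix *)

Section Precision.
Context {R : realType} {G : metric_graph R}.
Implicit Types (e : edge G) (kappa tau : R).

(** With z = exp(-kappa l), the fractions in z are coth(kappa l) and 1 / sinh(kappa l). The second
    identity is tanh(x / 2) = coth x - 1 / sinh x, doubled: a loop adds up all four entries of its
    edge block. *)
Lemma precision_diag_coef kappa l : 0 < kappa -> 0 < l ->
  let z := expR (- kappa * l) in
  2 * (1 / 2 + expR (- 2 * kappa * l) / (1 - expR (- 2 * kappa * l))) =
    (1 + z ^+ 2) / (1 - z ^+ 2) /\
  2 * tanh (kappa * (l / 2)) =
    2 * ((1 + z ^+ 2) / (1 - z ^+ 2)) - 2 * (2 * z / (1 - z ^+ 2)).
Proof.
move=> k0 l0 z.
have /andP[z0 z1] := expRN_lt1 k0 l0; rewrite -/z in z0 z1.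
have E2 : expR (- 2 * kappa * l) = z ^+ 2.
  by rewrite /z expr2 -expRD; congr expR; ring.
set w := expR (- (kappa * (l / 2))).
have w0 : 0 < w by exact: expR_gt0.
have Ew : w ^+ 2 = z by rewrite /w /z expr2 -expRD; congr expR; field.
have wn : w != 0 by rewrite gt_eqF.
have zz : 1 - z ^+ 2 != 0 by rewrite gt_eqF// subr_gt0 expr_lt1// ltW.
have zp : 1 + z != 0 by rewrite gt_eqF// addr_gt0.
have wp : 1 + w ^+ 2 != 0 by rewrite Ew.
have zm : 1 - z != 0 by rewrite gt_eqF// subr_gt0.
rewrite E2; split; first by field; rewrite zz.
have -> : tanh (kappa * (l / 2)) = (1 - z) / (1 + z).
  rewrite /tanh -/w.
  have -> : expR (kappa * (l / 2)) = w^-1 by rewrite /w expRN invrK.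
  by rewrite -Ew; field; rewrite wn wp.
have -> : 1 - z ^+ 2 = (1 - z) * (1 + z) by ring.
by field; rewrite zp zm.
Qed.

Lemma precision_offdiag_coef kappa l :
  let z := expR (- kappa * l) in
  2 * (expR (- kappa * l) / (1 - expR (- 2 * kappa * l))) = 2 * z / (1 - z ^+ 2).
Proof.
move=> z; have -> : expR (- 2 * kappa * l) = z ^+ 2.
  by rewrite /z expr2 -expRD; congr expR; ring.
by rewrite mulrA.
Qed.

(** Each edge contributes a 2 by 2 block indexed by its two ends. When they coincide the four
    entries fall on one diagonal place, so a single formula covers loops. *)
Lemma precision_edge_sum kappa tau n (v : 'I_n -> vertex G) : 0 < kappa ->
  injective v -> forall i j, precision kappa tau v i j = tau ^+ 2 *
  \sum_e (let z := expR (- kappa * len e) in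
    kappa * ((1 + z ^+ 2) / (1 - z ^+ 2) *
      ((v i == edge_tail e)%:R * (v j == edge_tail e)%:R
       + (v i == edge_head e)%:R * (v j == edge_head e)%:R)
    - 2 * z / (1 - z ^+ 2) *
      ((v i == edge_tail e)%:R * (v j == edge_head e)%:R
       + (v i == edge_head e)%:R * (v j == edge_tail e)%:R))).
Proof.
move=> k0 vinj i j; rewrite mxE.
have -> : 2 * kappa * tau ^+ 2 = tau ^+ 2 * kappa * 2 by ring.
rewrite -!mulrA; congr (_ * _); rewrite -mulr_sumr; congr (_ * _).
have [<-|ij] := eqVneq i j.
  congr (_ * _); rewrite mulr_sumr big_mkcond/=; apply: eq_bigr => e _.
  have [A B] := precision_diag_coef k0 (len_gt0 e).
  rewrite /incident mulrDr (mulrA 2 (_ + _)) A (mulrA 2 (tanh _)) B !(eq_sym (v i)).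
  have [th|th] := eqVneq (edge_tail e) (v i);
  have [hh|hh] := eqVneq (edge_head e) (v i) => /=.
  - by rewrite th hh eqxx /=; ring.
  - by rewrite th (negbTE hh) /=; ring.
  - by rewrite hh eq_sym (negbTE th) /=; ring.
  - ring.
congr (_ * _); rewrite mulr_sumr big_mkcond/=; apply: eq_bigr => e _.
have C := precision_offdiag_coef kappa (len e).
have vij : v i != v j by apply: contra ij => /eqP/vinj ->.
rewrite mulrN C /incident !(eq_sym (v _)).
have both x : (x == v i) && (x == v j) = false.
  by apply/negbTE; apply: contra vij => /andP[/eqP <- /eqP <-].
move: (both (edge_tail e)) (both (edge_head e)).
case: (edge_tail e == v i); case: (edge_tail e == v j);
  case: (edge_head e == v i); case: (edge_head e == v j) => //= _ _; ring.
Qed.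

(** The sum of indicators lets products of vertex values expand into bilinear forms in the
    entries. *)
Definition vertex_values n (v : 'I_n -> vertex G) (b : 'cV[R]_n) (x : vertex G) : R :=
  \sum_j (v j == x)%:R * b j 0.

Lemma vertex_valuesE n (v : 'I_n -> vertex G) (b : 'cV[R]_n) i : injective v ->
  vertex_values v b (v i) = b i 0.
Proof.
move=> vinj; rewrite /vertex_values (bigD1 i)//= eqxx mul1r big1 ?addr0//.
by move=> j ji; rewrite (inj_eq vinj) (negbTE ji) mul0r.
Qed.

Lemma sum_vertex_values n (v : 'I_n -> vertex G) (b c : 'cV[R]_n) x y :
  \sum_i \sum_j c i 0 * ((v i == x)%:R * (v j == y)%:R) * b j 0 =
  vertex_values v c x * vertex_values v b y.
Proof.
rewrite /vertex_values mulr_suml; apply: eq_bigr => i _.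
by rewrite mulr_sumr; apply: eq_bigr => j _; ring.
Qed.

(** Summing the edge blocks against b and c pairs fluxes with vertex values: Q is tau^2 times the
    Dirichlet-to-Neumann map of kappa^2 - d^2/dt^2 at the vertices. *)
Lemma precision_form kappa tau n (v : 'I_n -> vertex G) (b c : 'cV[R]_n) :
  0 < kappa -> injective v ->
  \sum_i \sum_j c i 0 * precision kappa tau v i j * b j 0 =
  tau ^+ 2 * \sum_e
    (flux kappa (len e) (vertex_values v b (edge_tail e)) (vertex_values v b (edge_head e))
       * vertex_values v c (edge_tail e)
     + flux kappa (len e) (vertex_values v b (edge_head e)) (vertex_values v b (edge_tail e))
       * vertex_values v c (edge_head e)).
Proof.
move=> k0 vinj.
transitivity (\sum_i \sum_j \sum_e tau ^+ 2 * (c i 0 *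
  (let z := expR (- kappa * len e) in
    kappa * ((1 + z ^+ 2) / (1 - z ^+ 2) *
      ((v i == edge_tail e)%:R * (v j == edge_tail e)%:R
       + (v i == edge_head e)%:R * (v j == edge_head e)%:R)
    - 2 * z / (1 - z ^+ 2) *
      ((v i == edge_tail e)%:R * (v j == edge_head e)%:R
       + (v i == edge_head e)%:R * (v j == edge_tail e)%:R))) * b j 0)).
  apply: eq_bigr => i _; apply: eq_bigr => j _.
  rewrite precision_edge_sum// mulrCA -mulrA mulr_sumr mulr_suml mulr_sumr.
  by apply: eq_bigr => e _; rewrite !mulrA.
under eq_bigr do rewrite exchange_big/=.
rewrite exchange_big/= mulr_sumr; apply: eq_bigr => e _.
rewrite /flux; set z := expR _; set C := _ / _; set D := 2 * z / _.
transitivity (tau ^+ 2 * kappa *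
  (C * (\sum_i \sum_j c i 0 * ((v i == edge_tail e)%:R * (v j == edge_tail e)%:R) * b j 0
      + \sum_i \sum_j c i 0 * ((v i == edge_head e)%:R * (v j == edge_head e)%:R) * b j 0)
  - D * (\sum_i \sum_j c i 0 * ((v i == edge_tail e)%:R * (v j == edge_head e)%:R) * b j 0
      + \sum_i \sum_j c i 0 * ((v i == edge_head e)%:R * (v j == edge_tail e)%:R) * b j 0))).
  rewrite -!big_split/= !mulr_sumr -sumrB mulr_sumr; apply: eq_bigr => i _.
  rewrite -!big_split/= !mulr_sumr -sumrB mulr_sumr; apply: eq_bigr => j _.
  by ring.
by rewrite !sum_vertex_values; ring.
Qed.

Lemma precision_tr kappa tau n (v : 'I_n -> vertex G) : 0 < kappa ->
  injective v -> (precision kappa tau v)^T = precision kappa tau v.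
Proof.
move=> k0 vinj; apply/matrixP => i j; rewrite mxE !precision_edge_sum//.
by congr (_ * _); apply: eq_bigr => e _ /=; ring.
Qed.

(** The constant is the smaller eigenvalue kappa (1 - z)^2 / (1 - z^2) of the edge block, with z =
    exp(-kappa l); the remainder is a nonnegative multiple of (x - y)^2. *)
Lemma flux_form_ge kappa l x y : 0 < kappa -> 0 < l ->
  exists2 c, 0 < c &
    c * (x ^+ 2 + y ^+ 2) <= flux kappa l x y * x + flux kappa l y x * y.
Proof.
move=> k0 l0; rewrite /flux; have /andP[] := expRN_lt1 k0 l0.
move: (expR _) => z z0 z1.
have zz : 0 < 1 - z ^+ 2 by rewrite subr_gt0 expr_lt1// ltW.
exists (kappa * ((1 - z) ^+ 2 / (1 - z ^+ 2))).
  by apply: mulr_gt0 => //; apply: divr_gt0 => //; apply: exprn_gt0; rewrite subr_gt0.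
rewrite -subr_ge0.
have -> : kappa * ((1 + z ^+ 2) / (1 - z ^+ 2) * x - 2 * z / (1 - z ^+ 2) * y) * x +
  kappa * ((1 + z ^+ 2) / (1 - z ^+ 2) * y - 2 * z / (1 - z ^+ 2) * x) * y -
  kappa * ((1 - z) ^+ 2 / (1 - z ^+ 2)) * (x ^+ 2 + y ^+ 2) =
  kappa * (2 * z) / (1 - z ^+ 2) * (x - y) ^+ 2 by field; rewrite gt_eqF.
rewrite mulr_ge0 ?sqr_ge0// divr_ge0 ?(ltW zz)// mulr_ge0 ?(ltW k0)//.
by rewrite mulr_ge0// ltW.
Qed.

(** Unless x is the tail of a chosen edge, the first step of a path from x to that tail runs along
    an edge at x. *)
Lemma exists_incident_edge (x : vertex G) : exists e, incident e x.
Proof.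
have [e0 _] : exists e0 : edge G, e0 \in predT by apply/card_gt0P; exact: edge_nonempty.
have [<-|xe] := eqVneq (edge_tail e0) x; first by exists e0; rewrite /incident eqxx.
have /connectP[[|y p]/=] := graph_connected x (edge_tail e0).
  by move=> _ E; rewrite E eqxx in xe.
move=> /andP[/existsP[e]]; rewrite /incident => H _ _; exists e.
by move: H => /orP[/andP[-> _]//|/andP[_ ->]]; rewrite orbT.
Qed.

(** On a kernel vector the nonnegative edge forms sum to 0, so each vanishes together with the
    values at both ends of its edge, and every vertex is an end of some edge. *)
Lemma precision_unitmx kappa tau n (v : 'I_n -> vertex G) : 0 < kappa ->
  0 < tau -> bijective v -> precision kappa tau v \in unitmx.
Proof.
move=> k0 t0 vb; have vinj := bij_inj vb.
rewrite unitmxE unitfE; apply/det0P => -[c c0 cQ].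
have q0 : \sum_i \sum_j c^T i 0 * precision kappa tau v i j * c^T j 0 = 0.
  rewrite exchange_big/= big1// => j _.
  have cj : (c *m precision kappa tau v) 0 j = 0 by rewrite cQ mxE.
  rewrite mxE in cj; rewrite -mulr_suml (_ : \sum_i _ = 0) ?mul0r//.
  by apply: etrans cj; apply: eq_bigr => i _; rewrite [c^T _ _]mxE.
rewrite precision_form// in q0; move/eqP: q0.
rewrite mulf_eq0 expf_eq0/= (gt_eqF t0)/= psumr_eq0; last first.
  move=> e _; set x := vertex_values _ _ _; set y := vertex_values _ _ _.
  have [m m0] := flux_form_ge x y k0 (len_gt0 e); apply: le_trans.
  by rewrite mulr_ge0 ?(ltW m0)// addr_ge0 ?sqr_ge0.
move=> /allP z0; case/eqP: c0; apply/rowP => i; rewrite !mxE.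
have -> : c 0 i = vertex_values v c^T (v i) by rewrite vertex_valuesE// mxE.
have [e] := exists_incident_edge (v i).
have /implyP/(_ isT) := z0 e (mem_index_enum e).
set x := vertex_values _ _ _; set y := vertex_values _ _ _ => /eqP xy0.
have [m m0] := flux_form_ge x y k0 (len_gt0 e); rewrite xy0.
rewrite pmulr_rle0// => xy.
have x2 := sqr_ge0 x; have y2 := sqr_ge0 y.
have x0 : x = 0 by apply/eqP; rewrite -sqrf_eq0; apply/eqP; lra.
have y0 : y = 0 by apply/eqP; rewrite -sqrf_eq0; apply/eqP; lra.
by rewrite /incident => /orP[/eqP <-|/eqP <-].
Qed.

End Precision.

(** * Law of the vertex values *)

Section VertexCovariance.
Context {R : realType} {G : metric_graph R}.
Local Notation mu := (@lebesgue_measure R).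

(** Q b = tau^2 a, so with this b the fluxes leaving the vertices have the prescribed totals a. *)
Lemma flux_sum (kappa tau : R) n (v : 'I_n -> vertex G) (a c : 'cV[R]_n) :
  0 < kappa -> 0 < tau -> bijective v ->
  let b := tau ^+ 2 *: (invmx (precision kappa tau v) *m a) in
  \sum_e
    (flux kappa (len e) (vertex_values v b (edge_tail e)) (vertex_values v b (edge_head e))
       * vertex_values v c (edge_tail e)
     + flux kappa (len e) (vertex_values v b (edge_head e)) (vertex_values v b (edge_tail e))
       * vertex_values v c (edge_head e)) = \sum_i a i 0 * c i 0.
Proof.
move=> k0 t0 vb b; have Qu := precision_unitmx k0 t0 vb.
have t2 : tau ^+ 2 != 0 by rewrite expf_neq0 ?gt_eqF.
apply: (mulfI t2); rewrite -precision_form//; last exact: bij_inj.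
have Qb : precision kappa tau v *m b = tau ^+ 2 *: a by rewrite -scalemxAr mulKVmx.
rewrite mulr_sumr; apply: eq_bigr => i _.
have /matrixP/(_ i 0) := Qb; rewrite [in X in X -> _]mxE [X in _ = X -> _]mxE => E.
rewrite mulrA -E mulr_suml; apply: eq_bigr => j _.
by ring.
Qed.

(** The Gaussian family supplies a centered normal law with some variance; the isometry of the noise
    gives the second moment, which identifies it. *)
Lemma normal_law_white_noise (d : measure_display) (Omega : measurableType d)
    (P : probability Omega R) (W : (edge G -> R -> R) -> {RV P >-> R}) h :
  white_noise W -> L2_graph h -> normal_law P (W h) 0 (L2_inner h h).
Proof.
move=> [gW cov] Lh.
have [Sigma [_ lawW]] := gW 1%N (fun=> h) (fun=> Lh).
have := lawW (\col_i 1); rewrite mulmx0 mxE.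
have -> : (fun w => \sum_(i < 1) (\col_i 1) i 0 * W h w) = W h.
  by apply/funext => w; rewrite big_ord1 mxE mul1r.
set s := (X in normal_law _ _ _ X) => law.
have mW : measurable_fun setT (W h) by exact: measurable_funPT.
suff <- : s = L2_inner h h by [].
apply: (normal_law_second_moment mW law).
have := cov h h Lh Lh; rewrite unlock => <-.
by apply: eq_integral => w _; rewrite expr2.
Qed.

Lemma vertex_values_eval (f : graph_point G -> R) n (v : 'I_n -> vertex G) x :
  bijective v -> vertex_values v (\col_i f (Vertex (v i))) x = f (Vertex x).
Proof.
move=> vb; have [w _ wv] := vb.
by rewrite -(wv x) vertex_valuesE ?mxE//; exact: bij_inj.
Qed.

Lemma continuous_graph_ends (f : graph_point G -> R) e : continuous_graph f ->
  exists r, [/\ continuous r, {in `[0, len e], restr f e =1 r},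
    equicontinuous_end false (len e) (fun=> r) (f (Vertex (edge_tail e))) &
    equicontinuous_end true (len e) (fun=> r) (f (Vertex (edge_head e)))].
Proof.
move=> cf; have l0 := len_gt0 e.
have cr := continuous_clamp (ltW l0) (cf e).
have re h : (restr f e \o clamp (len e)) (end_point h (len e)) =
    f (Vertex (if h then edge_head e else edge_tail e)).
  rewrite /= clamp_id ?end_point_itv// /end_point /restr.
  by case: h; rewrite ?edge_point0 ?edge_point_len.
exists (restr f e \o clamp (len e)); split=> //.
- by move=> t tl /=; rewrite clamp_id.
- by rewrite -(re false); exact: equicontinuous_end_cst.
- by rewrite -(re true); exact: equicontinuous_end_cst.
Qed.

Lemma cvgn_sum (I : Type) (r : seq I) (f : I -> nat -> R) (a : I -> R) :
  (forall i, f i @ \oo --> a i) ->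
  (fun n => \sum_(i <- r) f i n) @ \oo --> \sum_(i <- r) a i.
Proof.
move=> fa; elim: r => [|i r ih].
  by rewrite big_nil; under eq_fun do rewrite big_nil; exact: cvg_cst.
rewrite big_cons; under eq_fun do rewrite big_cons.
exact: (@cvgD _ R^o).
Qed.

End VertexCovariance.

Theorem corollary3 (R : realType) (G : metric_graph R) (kappa tau : R)
    (d : measure_display) (Omega : measurableType d) (P : probability Omega R)
    (W : (edge G -> R -> R) -> {RV P >-> R})
    (u : graph_point G -> {RV P >-> R})
    (v : 'I_#|vertex G| -> vertex G) :
  0 < kappa -> 0 < tau -> bijective v ->
  white_noise W -> whittle_matern kappa tau 1 W u ->
  precision kappa tau v \in unitmx /\
  multivariate_normal (fun i => u (Vertex (v i))) 0
    (invmx (precision kappa tau v)).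
Proof.
move=> k0 t0 vb wn [gu cu [T powT uW]].
have Qu := precision_unitmx k0 t0 vb; split=> //.
split; first by rewrite trmx_inv precision_tr//; exact: bij_inj.
(* The projection of U_v on a is already known to be centered normal, so only its variance [s] has
   to be found. *)
move=> a; have [Sigma [_ lawu]] := gu _ (fun i => Vertex (v i)) (fun=> I).
have := lawu a; set s := (X in normal_law _ _ _ X) => law.
suff <- : s = (a^T *m invmx (precision kappa tau v) *m a) 0 0 by [].
rewrite mulmx0 mxE in law.
pose b := tau ^+ 2 *: (invmx (precision kappa tau v) *m a).
pose bt e := vertex_values v b (edge_tail e).
pose bh e := vertex_values v b (edge_head e).
pose g n e := edge_approx kappa (len e) (bt e) (bh e) n.
pose g1 n e := edge_approx1 kappa (len e) (bt e) (bh e) n.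
pose g2 n e := edge_approx2 kappa (len e) (bt e) (bh e) n.
(* This is L g_n, computed edge by edge. *)
pose psi n e t := kappa ^+ 2 * g n e t - g2 n e t.
have dg n e (t : R) : is_derive t 1 (g n e) (g1 n e t) by exact: is_derive_edge_approx.
have dg1 n e (t : R) : is_derive t 1 (g1 n e) (g2 n e t).
  by apply: is_derive_edge_approx1; exact: len_gt0.
have cg n e : continuous (g n e) := is_derive_continuous (dg n e).
have cg2 n e : continuous (g2 n e).
  by apply: continuous_edge_approx2; exact: len_gt0.
have Lg n : L2_graph (g n) by move=> e; exact: L2_itv_continuous.
have Lpsi n : L2_graph (psi n).
  move=> e; apply: L2_itv_continuous; have ? := cg n e; have ? := cg2 n e.
  by rewrite /psi; cont.
have LT n : L2_graph (T (psi n)).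
  by have [lambda [phi [_ HT]]] := powT; have [] := HT _ (Lpsi n).
pose h n e t := tau^-1 * T (psi n) e t.
have Lh n : L2_graph (h n) by exact: L2_graphZ.
have hh n : L2_inner (h n) (h n) = tau ^- 2 * L2_inner (g n) (psi n).
  rewrite L2_innerZl// L2_innerC L2_innerZl// mulrA -expr2 exprVn; congr (_ * _).
  apply: (whittle_power_norm k0 powT) => // lambda phi eig.
  apply: (@eigenfunction_Green _ _ _ _ _ (vertex_values v b) (g n) (g1 n) (g2 n) eig) => // e.
  - by have [] := edge_approx_ends (bt e) (bh e) n k0 (len_gt0 e).
  - by have [] := edge_approx_ends (bt e) (bh e) n k0 (len_gt0 e).
apply: (@normal_law_cvg_variance R _ _ P (fun n => W (h n))
  (fun w => \sum_i a i 0 * u (Vertex (v i)) w) (fun n => L2_inner (h n) (h n))).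
- by move=> n; exact: measurable_funPT.
- by apply: measurable_sum => i; apply: measurable_funM => //; exact: measurable_funPT.
- by move=> n; exact: normal_law_white_noise.
- exact: law.
(* A single null set serves all n; outside it the path is continuous, and pairing it with L g_n
   tends to the flux sum with the path's vertex values, which is a . U_v. *)
- have := ae_foralln (fun n => uW (psi n) (Lpsi n)).
  apply: filterS2 cu => w cw Hw.
  have -> : (fun n => W (h n) w) =
      (fun n => L2_inner (restr (fun x => u x w)) (psi n)).
    by apply/funext => n; rewrite Hw.
  pose c := \col_i u (Vertex (v i)) w.
  have -> : \sum_i a i 0 * u (Vertex (v i)) w = \sum_i a i 0 * c i 0.
    by apply: eq_bigr => i _; rewrite mxE.
  rewrite -(flux_sum a c k0 t0 vb) -/b; apply: cvgn_sum => e.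
  rewrite !(vertex_values_eval (fun x => u x w))//.
  have [r [cr rE r0 rl]] := continuous_graph_ends e cw.
  have := @cvg_int_edge_approx R kappa (len e) (bt e) (bh e) (fun=> r) _ _ k0
    (len_gt0 e) (fun=> cr) r0 rl.
  apply: cvg_trans; apply: near_eq_cvg; near=> n.
  by apply: eq_int => t tl; rewrite rE.
(* In (g_n, L g_n) both factors vary with n, but g_n keeps the end values given by b, so the
   variances tend to tau^(-2) a . b = a^T Q^(-1) a. *)
- rewrite (funext hh).
  have -> : (a^T *m invmx (precision kappa tau v) *m a) 0 0 =
      tau ^- 2 * \sum_i a i 0 * b i 0.
    rewrite -mulmxA mxE mulr_sumr; apply: eq_bigr => i _.
    rewrite [b i 0]mxE [a^T 0 i]mxE; move: ((invmx _ *m a) i 0) => y.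
    by field; rewrite gt_eqF.
  apply: cvgMl_tmp; rewrite -(flux_sum a b k0 t0 vb) -/b; apply: cvgn_sum => e.
  apply: cvg_int_edge_approx => //; [exact: len_gt0| | ].
  + exact: (equicontinuous_end_approx false _ _ k0 (len_gt0 e)).
  + exact: (equicontinuous_end_approx true _ _ k0 (len_gt0 e)).
Unshelve. all: by end_near. Qed.
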